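(* Let $G=((X,Y),E)$ be a split graph with $\sigma(G)=2$ and odd maximum degree. Let $P$ be the set of pendant vertices of $G$, and let $H=G[V\setminus P]$. Then $G$ is Type 2 if and only if $\Delta(H)=\Delta(G)$ and $H$ satisfies Hilton's condition, namely $$|E(\overline{H})|+\alpha'(\overline{H})<\frac{|V(H)|}{2},$$ where $\overline{H}$ is the complement of $H$ and $\alpha'(\overline{H})$ is the maximum size of a matching in $\overline{H}$.
   Context: All graphs are simple, finite, connected and undirected. A split graph $G=((X,Y),E)$ is a graph whose vertex set is partitioned into a clique $X$ and an independent set $Y$; $X$ is taken to be a maximal clique. A tree $t$-spanner of a connected graph $G$ is a spanning tree $T$ of $G$ with $d_T(u,w)\le t$ for every edge $uw$ of $G$. The stretch index $\sigma(G)$ is the least $t$ for which $G$ admits a tree $t$-spanner. Pendant vertices are the vertices of degree $1$. A total coloring assigns colors to vertices and edges so that adjacent vertices, adjacent edges, and each vertex and its incident edges all receive distinct colors. The total chromatic number $\chi''(G)$ is the minimum number of colors in such a coloring. $G$ is Type 1 if $\chi''(G)=\Delta(G)+1$, and Type 2 if $\chi''(G)=\Delta(G)+2$; split graphs are known to satisfy one of these. *)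

(* Defs.v *)
From mathcomp Require Import all_boot all_order all_algebra.

Set Implicit Arguments.
Unset Strict Implicit.
Unset Printing Implicit Defensive.

Record sgraph (V : finType) := SGraph {
  adj :> rel V;
  adj_sym : symmetric adj;
  adj_irr : irreflexive adj
}.

Section Graphs.
Variable V : finType.
Implicit Types (G T : sgraph V) (X Y S : {set V}).

Definition edges G : {set {set V}} := [set [set p.1; p.2] | p : V * V & G p.1 p.2].

Definition degree G (x : V) : nat := #|[set y | G x y]|.

Definition max_degree G : nat := \max_(x : V) degree G x.

Definition connected G : Prop := forall x y : V, connect G x y.

Lemma compl_sym G : symmetric (fun x y : V => (x != y) && ~~ G x y).
Proof. by move=> x y; rewrite eq_sym adj_sym. Qed.

Lemma compl_irr G : irreflexive (fun x y : V => (x != y) && ~~ G x y).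
Proof. by move=> x; rewrite eqxx. Qed.

Definition compl G : sgraph V := SGraph (compl_sym G) (compl_irr G).

Lemma induced_sym G S : symmetric (fun x y : {z | z \in S} => G (val x) (val y)).
Proof. by move=> x y; rewrite adj_sym. Qed.

Lemma induced_irr G S :
  irreflexive (fun x y : {z | z \in S} => G (val x) (val y)).
Proof. by move=> x; rewrite adj_irr. Qed.

Definition induced G S : sgraph {z | z \in S} :=
  SGraph (@induced_sym G S) (@induced_irr G S).

Definition pendant G : {set V} := [set x | degree G x == 1].

Definition clique G X : bool :=
  [forall x in X, forall y in X, (x != y) ==> G x y].

Definition independent G Y : bool :=
  [forall x in Y, forall y in Y, ~~ G x y].

(* Maximality of the clique is with respect to inclusion. *)
Definition split_graph G X Y : Prop :=
  [/\ X :|: Y = [set: V], [disjoint X & Y],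
      maxset (clique G) X & independent G Y].

Definition acyclic G : Prop := forall s : seq V, ucycle G s -> size s <= 2.

Definition tree G : Prop := connected G /\ acyclic G.

(* Length of a shortest walk from x to y; the junk value #|V| is returned when
   there is none (a shortest walk has length less than #|V|). *)
Definition dist G (x y : V) : nat :=
  find (fun n => [exists p : n.-tuple V, path G x p && (last x p == y)])
       (iota 0 #|V|).

Definition spanning_tree G T : Prop := subrel T G /\ tree T.

Definition tree_spanner (t : nat) G T : Prop :=
  spanning_tree G T /\ forall u w : V, G u w -> dist T u w <= t.

Definition is_stretch_index G (s : nat) : Prop :=
  (exists T, tree_spanner s G T) /\
  (forall t : nat, (exists T, tree_spanner t G T) -> s <= t).

Definition matching G (M : {set {set V}}) : bool :=
  (M \subset edges G) && trivIset M.

Definition matching_number G : nat :=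
  \max_(M : {set {set V}} | matching G M) #|M|.

Definition total_element G : finType := (V + {A | A \in edges G})%type.

Definition conflict G (a b : total_element G) : bool :=
  match a, b with
  | inl x, inl y => G x y
  | inl x, inr A => x \in val A
  | inr A, inl x => x \in val A
  | inr A, inr B => (A != B) && ~~ [disjoint val A & val B]
  end.

Definition total_colorable G (k : nat) : bool :=
  [exists c : {ffun total_element G -> 'I_k},
    forall a, forall b, conflict a b ==> (c a != c b)].

Lemma total_colorable_ex G : exists k, total_colorable G k.
Proof.
exists #|{: total_element G}|; apply/existsP.
exists [ffun a => enum_rank a]; apply/forallP=> a; apply/forallP=> b.
apply/implyP=> cab; rewrite !ffunE; apply: contraL cab => /eqP/enum_rank_inj <-.
by case: a => [x|A] /=; rewrite ?adj_irr ?eqxx.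
Qed.

Definition total_chromatic_number G : nat := ex_minn (total_colorable_ex G).

Definition type2 G : Prop := total_chromatic_number G = max_degree G + 2.

(* The right-hand side is the exact rational |V| / 2, not rounded down. *)
Definition hilton_condition G : Prop :=
  ((#|edges (compl G)| + matching_number (compl G))%:R < #|V|%:R / 2%:R :> rat)%R.

End Graphs.

(* Main.v *)
Require Import Defs.
From mathcomp Require Import all_boot all_order all_algebra.
From mathcomp Require Import zify.

Set Implicit Arguments.
Unset Strict Implicit.
Unset Printing Implicit Defensive.

(* Let H be G without its pendant vertices. A tree 2-spanner contains a star that
   spans X, and its centre is universal in H, so Delta(H) = |V(H)| - 1. A total
   colouring of H with k > Delta(G) colours extends greedily to the pendant
   vertices, so only H matters; graphs of odd order N have total colourings with N
   colours, which leaves the case |V(H)| = Delta(G) + 1 = 2n. This case is Hilton's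
   theorem, with J the complement of H, e = |E(J)| and j its matching number.

   If 2n colours suffice, every colour with an odd number of vertices is missing at
   some vertex, so there are at most 2e of them; pairing up the vertices inside the
   classes gives 2n <= 2j + 2e.

   Conversely, if e + j >= n, then since the edges of J are pairwise linked one finds
   a set F of k of them spanning a set S of at most k + 1 <= n vertices, with a
   matching M in F of size n - k. View a total colouring of K_2n - F as a
   2n x 2n array with injective rows, symmetric outside F, the diagonal carrying the
   vertex colours. The S x S block is filled greedily with prescribed diagonal and
   prescribed entries on F chosen so that the parity of every symbol is right, and
   the block is then extended one row and column at a time, as in Cruse's embedding
   theorem for symmetric latin squares. *)

(** * Systems of distinct representatives *)

(** Hall's marriage theorem by induction on [#|A|]: a nonempty proper tight subset is matched
    separately from the rest; without one, any single choice leaves enough candidates. [f0] only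
    serves as a default off [A]. *)
Lemma hall (I C : finType) (f0 : I -> C) (r : I -> {set C}) (A : {set I}) :
  (forall Q : {set I}, Q \subset A -> #|Q| <= #|\bigcup_(i in Q) r i|) ->
  exists f : I -> C, {in A &, injective f} /\ {in A, forall i, f i \in r i}.
Proof.
have [n] := ubnP #|A|; elim: n => // n IHn in A r *; rewrite ltnS => leAn hallA.
have [->|/set0Pn[a aA]] := eqVneq A set0.
  by exists f0; split=> [x y|x]; rewrite inE.
pose N (Q : {set I}) := \bigcup_(i in Q) r i.
have [/existsP[Q /and3P[Qpr Q0 /eqP NQ]]|/existsPn noQ] :=
    boolP [exists Q : {set I}, [&& Q \proper A, Q != set0 & #|N Q| == #|Q|]].
  have QA := proper_sub Qpr.
  have ltQA := proper_card Qpr.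
  have [||f [finj fr]] := IHn Q r; first exact: leq_trans ltQA leAn.
    by move=> Q' Q'Q; apply: hallA; apply: subset_trans QA.
  (* As [Q] is tight, deleting [N Q] from the candidates preserves Hall's condition: apply it to
     [Q :|: Q']. *)
  have [||g [ginj gr]] := IHn (A :\: Q) (fun i => r i :\: N Q).
  - by move: Q0; rewrite -card_gt0 => ?; rewrite cardsD (setIidPr QA); lia.
  - move=> Q'; rewrite subsetD => /andP[Q'A dQ].
    have := hallA (Q :|: Q'); rewrite subUset QA Q'A => /(_ isT).
    rewrite bigcup_setU -/(N Q) -/(N Q') cardsU disjoint_setI0 1?disjoint_sym //.
    rewrite cards0 subn0.
    have -> : \bigcup_(i in Q') (r i :\: N Q) = N Q' :\: N Q.
      apply/setP=> k; rewrite in_setD; apply/bigcupP/andP.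
        by case=> i iQ /setDP[ki kN]; split=> //; apply/bigcupP; exists i.
      by case=> kN /bigcupP[i iQ ki]; exists i => //; apply/setDP.
    by have := cardsU (N Q) (N Q'); rewrite cardsD [N Q' :&: _]setIC; lia.
  exists (fun i => if i \in Q then f i else g i); split.
  - move=> x y xA yA; case: ifPn => xQ; case: ifPn => yQ.
    + exact: finj.
    + move=> fg; have /setDP[_ /negP[]] : g y \in r y :\: N Q by apply: gr; rewrite inE yQ.
      by rewrite -fg; apply/bigcupP; exists x => //; apply: fr.
    + move=> fg; have /setDP[_ /negP[]] : g x \in r x :\: N Q by apply: gr; rewrite inE xQ.
      by rewrite fg; apply/bigcupP; exists y => //; apply: fr.
    + by apply: ginj; rewrite inE ?xQ ?yQ.
  - move=> x xA; case: ifPn => xQ; first exact: fr.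
    by have /setDP[] : g x \in r x :\: N Q by apply: gr; rewrite inE xQ.
(* With no tight proper subset, every nonempty set avoiding [a] has a spare candidate, so giving [k]
   to [a] is harmless. *)
have /card_gt0P[k ka] : 0 < #|r a|.
  by have := hallA [set a]; rewrite sub1set aA cards1 big_set1 => /(_ isT).
have [||f [finj fr]] := IHn (A :\ a) (fun i => r i :\ k).
- by move: leAn; rewrite (cardsD1 a) aA.
- move=> Q QA; have [->|Q0] := eqVneq Q set0; first by rewrite cards0.
  have Qpr : Q \proper A by apply: sub_proper_trans QA _; rewrite properD1.
  have := noQ Q; rewrite Qpr Q0 /= => neQ.
  have leQ := hallA Q (proper_sub Qpr).
  have -> : \bigcup_(i in Q) (r i :\ k) = N Q :\ k.
    apply/setP=> j; rewrite in_setD1; apply/bigcupP/andP.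
      by case=> i iQ /setD1P[ki kN]; split=> //; apply/bigcupP; exists i.
    by case=> kN /bigcupP[i iQ ki]; exists i => //; apply/setD1P.
  by have := cardsD1 k (N Q); move: neQ leQ; rewrite -/(N Q); case: (k \in N Q); lia.
exists (fun i => if i == a then k else f i); split.
- move=> x y xA yA; case: eqVneq => [->|xa]; case: eqVneq => [->|ya] //.
  + by move=> kf; have := fr y; rewrite !inE ya yA -kf eqxx => /(_ isT).
  + by move=> kf; have := fr x; rewrite !inE xa xA kf eqxx => /(_ isT).
  + by apply: finj; rewrite !inE ?xa ?ya.
- move=> x xA; case: eqVneq => [->//|xa].
  by have := fr x; rewrite !inE xa xA => /(_ isT)/andP[].
Qed.

(** König's theorem for integer matrices with constant line sums: weighing the rows of [Q] against
    the columns they meet gives Hall's condition. *)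
Lemma regular_transversal (I C : finType) (f0 : I -> C) (w : I -> C -> nat) (d : nat) :
  0 < d -> (forall i, \sum_k w i k = d) -> (forall k, \sum_i w i k = d) ->
  exists2 f : I -> C, injective f & forall i, 0 < w i (f i).
Proof.
move=> d0 rows cols.
have [|f [finj fr]] := @hall I C f0 (fun i => [set k | 0 < w i k]) setT.
  move=> Q _; rewrite -(leq_pmul2r d0).
  set N := \bigcup_(i in Q) _.
  have -> : #|Q| * d = \sum_(i in Q) \sum_(k in N) w i k.
    rewrite -sum_nat_const; apply: eq_bigr => i iQ; rewrite -(rows i).
    rewrite (bigID [in N]) /= [X in _ + X]big1 ?addn0 // => k kN.
    apply/eqP; rewrite -leqn0 leqNgt; apply: contra kN => wk.
    by apply/bigcupP; exists i; rewrite ?inE.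
  rewrite exchange_big /= -sum_nat_const; apply: leq_sum => k _.
  by rewrite -(cols k) [X in _ <= X](bigID [in Q]) /= leq_addr.
exists f; first by move=> x y; apply: finj; rewrite inE.
by move=> i; have := fr i; rewrite !inE => /(_ isT).
Qed.

(** * Extension of partial arrays *)

Definition missing (V : finType) (S : {set V}) (L : V -> V -> V) (k : V) :=
  #|[set x in S | k \notin L x @: S]|.

(** [W] holds the symbols reserved for the diagonal cells outside [S]. The last clause is Cruse's
    condition: in a completed array each of the [#|W|] new rows contains [k] once, either in a
    column of [S] (one such row for each old row missing [k]), or on the diagonal (once, if [k] is
    in [W]), or in symmetric pairs of cells between new vertices. This dictates the bound and the
    parity. *)
Definition partial_array (V : finType) (F : rel V) (S : {set V})
    (L : V -> V -> V) (W : {set V}) : Prop :=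
  [/\ {in S, forall x, {in S &, injective (L x)}},
      {in S &, forall x y, ~~ F x y -> L x y = L y x},
      {in S &, forall x y, x != y -> ~~ F x y -> L x x != L y y},
      {in S, forall x, L x x \notin W} &
      #|W| + #|S| = #|V| /\
      forall k, missing S L k + (k \in W) <= #|W| /\
                odd (missing S L k + (k \in W)) = odd #|W|].

Lemma sum_bool_card (T : finType) (A P : pred T) :
  \sum_(k | A k) (P k : nat) = #|[set k | A k && P k]|.
Proof.
by rewrite -sum1dep_card big_mkcondr; apply: eq_bigr => k _; case: (P k).
Qed.

Lemma sum_missing (V : finType) (S : {set V}) (L : V -> V -> V) :
  {in S, forall x, {in S &, injective (L x)}} ->
  \sum_k missing S L k = #|S| * (#|V| - #|S|).
Proof.
move=> Linj; rewrite -sum_nat_const.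
under eq_bigr => k _ do rewrite /missing -sum1dep_card big_mkcondr.
rewrite exchange_big /=; apply: eq_bigr => x xS.
rewrite -big_mkcond sum1dep_card -(card_in_imset (Linj x xS)).
have -> : #|V| - #|L x @: S| = #|~: (L x @: S)| by rewrite [RHS]cardsCs setCK.
by apply: eq_card => k; rewrite !inE.
Qed.

(** The new row and column come from one transversal [psi]: for [x] in [S], [psi x] fills the cells
    [(x, u)] and [(u, x)]; [psi u] is the diagonal entry; the remaining vertices are dummies that
    absorb the symbols left out of row [u] for now. *)
Lemma extend_vertex (V : finType) (F : rel V) (S : {set V}) (L : V -> V -> V)
    (W : {set V}) (u : V) :
  u \notin S -> partial_array F S L W ->
  exists L' W', partial_array F (u |: S) L' W'.
Proof.
move=> uS [Linj Lsym Ldiag LW [cardW Lmiss]].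
have ltS : #|S| < #|V|.
  by have := max_card [in u |: S]; rewrite cardsU1 uS.
pose g := #|W|; pose a := missing S L; pose v k : nat := k \in W.
(* [l k] is the slack in Cruse's condition; a symbol without slack cannot go to a dummy. Each of the
   [g - 1] dummy rows sums to [g * (g - 1)], hence the factor [c] on the other rows; the maximum
   with 1 covers [g = 1], where there is no dummy. *)
pose l k := g - (a k + v k).
pose c := maxn 1 g.-1.
have c0 : 0 < c by rewrite leq_max.
have g0 : 0 < g by rewrite /g; lia.
have others : #|[set i | (i \notin S) && (i != u)]| = g.-1.
  have -> : [set i | (i \notin S) && (i != u)] = ~: (u |: S).
    by apply/setP=> i; rewrite !inE negb_or andbC.
  by rewrite cardsCs setCK cardsU1 uS /g; lia.
have cg : g.-1 <> 0 -> c = g.-1 by rewrite /c; lia.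
pose w i k := if i \in S then c * (k \notin L i @: S)
              else if i == u then c * v k else l k.
have sumv : \sum_k v k = g 
  by rewrite sum_bool_card; apply: eq_card => k; rewrite inE.
have rows i : \sum_k w i k = c * g.
  rewrite /w; case: (boolP (i \in S)) => iS.
    rewrite -big_distrr sum_bool_card.
    congr (_ * _); rewrite /g; have := card_in_imset (Linj i iS).
    have -> : [set k | true && (k \notin L i @: S)] = ~: (L i @: S) by apply/setP=> k; rewrite !inE.
    by have := cardsCs (~: (L i @: S)); rewrite setCK; lia.
  case: (eqVneq i u) => iu; first by rewrite -big_distrr /= sumv.
  have -> : \sum_k l k = \sum_(k : V) g - (\sum_k a k + \sum_k v k).
    have <- : \sum_k (a k + v k) = \sum_k a k + \sum_k v k by rewrite big_split.
    by apply: sumnB => k _; case: (Lmiss k).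
  rewrite sumv /a sum_missing // sum_nat_const cg; last first.
    rewrite -others; apply/eqP; rewrite cards_eq0.
    by apply/set0Pn; exists i; rewrite !inE iS iu.
  rewrite -cardW -/g addnK mulnDl.
  by rewrite subnDA addnK -[X in _ - X]mul1n -mulnBl subn1.
have cols k : \sum_i w i k = c * g.
  rewrite (bigID [in S]) /=.
  rewrite (eq_bigr (fun i => c * (k \notin L i @: S))); last first.
    by move=> i iS; rewrite /w iS.
  rewrite -big_distrr sum_bool_card -/(missing S L k) -/(a k).
  rewrite (bigD1 u) //= {1}/w (negPf uS) eqxx.
  rewrite (eq_bigr (fun i => l k)); last first.
    by move=> i /andP[iS iu]; rewrite /w (negPf iS) (negPf iu).
  rewrite sum_nat_cond_const /= others addnA -mulnDr.
  have [le odd_] := Lmiss k; rewrite -/(a k) -/(v k) -/g in le odd_.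
  (* Without dummies [g = 1], and the parity clause forces [a k + v k = 1]. *)
  have [g1|g1] := eqVneq g.-1 0.
    rewrite g1 mul0n addn0; congr (_ * _).
    have ge : g = 1 by lia.
    by move: odd_ le; rewrite ge; case: (_ + _) => [|[|]].
  rewrite -cg; last exact/eqP.
  by rewrite -mulnDr /l subnKC.
have cg0 : 0 < c * g by rewrite muln_gt0 c0.
have [psi psi_inj psi_w] := regular_transversal id cg0 rows cols.
have psiS x : x \in S -> psi x \notin L x @: S.
  by move=> xS; have := psi_w x; rewrite /w xS muln_gt0 lt0b => /andP[].
have psiu : psi u \in W.
  by have := psi_w u; rewrite /w (negPf uS) eqxx muln_gt0 lt0b => /andP[].
have psil z : z \notin S -> z != u -> a (psi z) + v (psi z) < g.
  by move=> zS zu; have := psi_w z; rewrite /w (negPf zS) (negPf zu) subn_gt0.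
pose L' x y := if x == u then psi y else if y == u then psi x else L x y.
have neu x : x \in S -> x != u by apply: contraTneq => ->.
have L'uE y : L' u y = psi y by rewrite /L' eqxx.
have L'xu x : L' x u = psi x by rewrite /L' eqxx; case: eqVneq => [->|].
have L'E x y : x \in S -> y \in S -> L' x y = L x y.
  by move=> xS yS; rewrite /L' (negPf (neu _ xS)) (negPf (neu _ yS)).
have L'S x : x \in S -> L' x @: (u |: S) = psi x |: L x @: S.
  move=> xS; rewrite imsetU1 L'xu; congr (_ |: _).
  by apply: eq_in_imset => y yS; apply: L'E.
exists L', (W :\ psi u); split.
- move=> x /setU1P[->|xS] y z yS zS; first by rewrite !L'uE => /psi_inj.
  move: yS zS => /setU1P[->|yS] /setU1P[->|zS] //; rewrite ?L'xu ?L'E //.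
  + by move=> e; have := psiS x xS; rewrite e imset_f.
  + by move=> e; have := psiS x xS; rewrite -e imset_f.
  + exact: Linj.
- move=> x y /setU1P[->|xS] /setU1P[->|yS] //; rewrite ?L'xu ?L'uE ?L'E //.
  exact: Lsym.
- move=> x y /setU1P[->|xS] /setU1P[->|yS]; rewrite ?eqxx ?L'uE ?L'E // => xy Fxy.
  + by apply: contraNneq (LW y yS) => <-.
  + by apply: contraNneq (LW x xS) => ->.
  + exact: Ldiag.
- move=> x /setU1P[->|xS]; rewrite inE ?L'uE ?in_set1 ?eqxx //.
  by rewrite L'E // (negPf (LW x xS)) andbF.
have cW : #|W| = #|W :\ psi u|.+1 by rewrite (cardsD1 (psi u)) psiu.
split; first by rewrite cardsU1 uS -cardW cW; lia.
move=> k.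
have missE : missing (u |: S) L' k =
    (k \notin psi @: (u |: S)) + #|[set x in S | (k \notin L x @: S) && (psi x != k)]|.
  rewrite /missing (cardsD1 u) !inE eqxx /= (eq_imset _ L'uE); congr (_ + _).
  apply: eq_card => x; rewrite !inE.
  have [->|xu] /= := eqVneq x u; first by rewrite (negPf uS).
  case: (boolP (x \in S)) => //= xS.
  by rewrite L'S // in_setU1 negb_or eq_sym andbC.
have [psi' _ psiK] := injF_bij psi_inj.
set i := psi' k; have ki : k = psi i by rewrite /i psiK.
have [lek oddk] := Lmiss k.
(* Three cases for the vertex [i] that receives [k]: in [S], a row stops missing [k]; at [u], [k]
   leaves [W]; at a dummy, the new row [u] misses [k]. *)
have [iS|iS] := boolP (i \in S).
  have e : missing S L k = #|[set x in S | (k \notin L x @: S) && (psi x != k)]|.+1.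
    rewrite /missing (cardsD1 i) inE iS ki psiS //= add1n; congr _.+1.
    apply: eq_card => x; rewrite !inE (inj_eq psi_inj).
    by rewrite andbC -andbA.
  have -> : missing (u |: S) L' k = (missing S L k).-1.
    by rewrite missE ki imset_f ?inE ?iS ?orbT // -ki e.
  have -> : (k \in W :\ psi u) = (k \in W).
    by rewrite in_setD1 ki (inj_eq psi_inj) neu.
  by move: e lek oddk; case: (missing S L k) => // m _; rewrite cW; lia.
have e : [set x in S | (k \notin L x @: S) && (psi x != k)] = [set x in S | k \notin L x @: S].
  apply/setP=> x; rewrite !inE ki (inj_eq psi_inj).
  case: eqVneq => [xi|]; last by rewrite andbT.
  by rewrite xi (negPf iS).
rewrite missE e -/(missing S L k).
have [iu|iu] := eqVneq i u.
  have kW : k \in W by rewrite ki iu.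
  have -> : k \in psi @: (u |: S) by rewrite ki iu imset_f // setU11.
  have -> : (k \in W :\ psi u) = false by rewrite ki iu setD11.
  by move: lek oddk; rewrite kW cW; lia.
have -> : k \notin psi @: (u |: S).
  rewrite ki; apply/imsetP=> -[x xuS /psi_inj ix].
  by move: xuS; rewrite -ix !inE (negPf iu) (negPf iS).
have -> : (k \in W :\ psi u) = (k \in W).
  by rewrite in_setD1 ki (inj_eq psi_inj) iu.
(* Here the count grows while [#|W|] shrinks; by parity a positive slack is at least 2, which is
   just enough. *)
by have := psil i iS iu; rewrite -ki /a /v /g; move: lek oddk; rewrite cW; lia.
Qed.

Lemma extend_array (V : finType) (F : rel V) (S : {set V}) (L : V -> V -> V)
    (W : {set V}) :
  partial_array F S L W -> exists L' W', partial_array F [set: V] L' W'.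
Proof.
have [n] := ubnP #|~: S|; elim: n => // n IHn in S L W *; rewrite ltnS => leS pa.
have [S0|/set0Pn[u]] := eqVneq (~: S) set0.
  by exists L, W; rewrite -[setT](setCK) setCT -S0 setCK.
rewrite inE => uS; have [L' [W' pa']] := extend_vertex uS pa.
apply: IHn pa'; apply: leq_trans leS; apply: proper_card.
by rewrite properEneq; apply/andP; split; rewrite ?setCS ?subsetUr //;
  apply: contraNneq uS => /setC_inj/setP/(_ u); rewrite !inE eqxx.
Qed.

(** * The initial block *)

Lemma set2_eq (T : finType) (a b x y : T) :
  ([set a; b] == [set x; y]) =
  ((a == x) && (b == y)) || ((a == y) && (b == x)).
Proof.
apply/eqP/idP => [e|/orP[]/andP[/eqP-> /eqP->] //]; last by rewrite setUC.
have : a \in [set x; y] by rewrite -e !inE eqxx.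
have : b \in [set x; y] by rewrite -e !inE eqxx orbT.
have : x \in [set a; b] by rewrite e !inE eqxx.
have : y \in [set a; b] by rewrite e !inE eqxx orbT.
rewrite !inE ![_ == a]eq_sym ![_ == b]eq_sym.
by case: (a == x); case: (a == y); case: (b == x); case: (b == y).
Qed.

Lemma edgesP (V : finType) (G : sgraph V) (A : {set V}) :
  reflect (exists x y, G x y /\ A = [set x; y]) (A \in edges G).
Proof.
apply: (iffP imsetP) => [[[x y]]|[x [y [Gxy ->]]]].
  by rewrite inE /= => Gxy ->; exists x, y.
by exists (x, y); rewrite ?inE.
Qed.

Lemma adj_neq (V : finType) (G : sgraph V) x y : G x y -> x != y.
Proof. by apply: contraTneq => ->; rewrite adj_irr. Qed.

Lemma mem_edges (V : finType) (G : sgraph V) x y : ([set x; y] \in edges G) = G x y.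
Proof.
apply/edgesP/idP => [[a [b [Gab /eqP]]]|Gxy]; last by exists x, y.
by rewrite set2_eq => /orP[]/andP[/eqP-> /eqP->]; rewrite // adj_sym.
Qed.

Lemma card_edge (V : finType) (G : sgraph V) A : A \in edges G -> #|A| = 2.
Proof. by case/edgesP=> x [y [/adj_neq xy ->]]; rewrite cards2 xy. Qed.

Lemma edge_adj (V : finType) (G : sgraph V) A x y :
  A \in edges G -> x \in A -> y \in A -> x != y -> G x y.
Proof.
case/edgesP=> a [b [Gab ->]]; rewrite !inE.
by move=> /orP[]/eqP-> /orP[]/eqP->; rewrite ?eqxx // adj_sym.
Qed.

Lemma card_adj_pairs (V : finType) (G : sgraph V) :
  #|[set p : V * V | G p.1 p.2]| = 2 * #|edges G|.
Proof.
pose f (p : V * V) := [set p.1; p.2].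
have -> : edges G = f @: [set p : V * V | G p.1 p.2].
  apply/setP=> A; apply/edgesP/imsetP => [[x [y [Gxy ->]]]|[p]].
    by exists (x, y); rewrite ?inE.
  by rewrite inE => Gp ->; exists p.1, p.2.
rewrite -sum1_card (partition_big_imset f) /= mulnC -sum_nat_const.
apply: eq_bigr => A /imsetP[[x y]]; rewrite inE /= => Gxy ->.
rewrite sum1dep_card.
have -> : [set p | (p \in [set p : V * V | G p.1 p.2]) && (f p == f (x, y))] =
          [set (x, y); (y, x)].
  apply/setP=> -[a b]; rewrite !inE /= set2_eq !xpair_eqE.
  apply/andP/idP => [[]//|]; case/orP=> /andP[/eqP-> /eqP->]; rewrite !eqxx ?orbT //.
  by rewrite adj_sym.
by rewrite cards2 xpair_eqE negb_and (adj_neq Gxy).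
Qed.

Lemma card_cover_matching (V : finType) (G : sgraph V) M :
  matching G M -> #|cover M| = 2 * #|M|.
Proof.
case/andP=> /subsetP MG /eqP <-; rewrite mulnC -sum_nat_const.
by apply: eq_bigr => A /MG/card_edge.
Qed.

Lemma inj_between (T U : finType) (f0 : T -> U) (A : {set T}) (B : {set U}) :
  #|A| <= #|B| -> exists f : T -> U, {in A &, injective f} /\ {in A, forall x, f x \in B}.
Proof.
rewrite !cardE => leAB; exists (fun x => nth (f0 x) (enum B) (index x (enum A))).
have idx x : x \in A -> index x (enum A) < size (enum B).
  by move=> xA; apply: leq_trans leAB; rewrite index_mem mem_enum.
split=> [x y xA yA|x xA]; last by rewrite -mem_enum mem_nth ?idx.
rewrite (set_nth_default (f0 x)) ?idx // => /eqP.
rewrite nth_uniq ?enum_uniq ?idx // => /eqP.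
by move=> e; have := congr1 (nth x (enum A)) e; rewrite !nth_index ?mem_enum.
Qed.

Definition occurrences (V : finType) (S : {set V}) (R : {set V * V})
    (L : V -> V -> V) (k : V) :=
  #|[set p in setX S S | (p \in R) && (L p.1 p.2 == k)]|.

(* An empty cell (x, z) has at most 2(|S| - 1) < |V| forbidden values, and
   filling it together with (z, x) preserves the parity of every count. *)
Lemma fill_block (V : finType) (F : rel V) (S : {set V}) (R : {set V * V})
    (L : V -> V -> V) :
  2 * #|S| <= #|V| ->
  (forall x, (x, x) \in R) ->
  (forall x y, ((x, y) \in R) = ((y, x) \in R)) ->
  (forall x y, F x y -> (x, y) \in R) ->
  {in S & & S, forall x y z, (x, y) \in R -> (x, z) \in R -> L x y = L x z -> y = z} ->
  {in S &, forall x y, (x, y) \in R -> ~~ F x y -> L x y = L y x} ->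
  exists L' : V -> V -> V,
    [/\ forall x, L' x x = L x x,
        {in S, forall x, {in S &, injective (L' x)}},
        {in S &, forall x y, ~~ F x y -> L' x y = L' y x} &
        forall k, odd (occurrences S setT L' k) = odd (occurrences S R L k)].
Proof.
move=> leS; have [n] := ubnP #|setX S S :\: R|.
elim: n => // n IHn in R L *; rewrite ltnS => len Rd Rs RF Linj Lsym.
have [/eqP|/set0Pn[[x z] /setDP[]]] := eqVneq (setX S S :\: R) set0.
  rewrite setD_eq0 => /subsetP SR; exists L; split=> //.
  - by move=> x xS y z yS zS; apply: Linj => //; apply: SR; apply/setXP.
  - by move=> x y xS yS; apply: Lsym => //; apply: SR; apply/setXP.
  - move=> k; congr odd; apply: eq_card => p; rewrite !inE.
    by apply: andb_id2l => pS; rewrite SR ?inE.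
move=> /setXP[/= xS zS] xzR.
have zxR : (z, x) \notin R by rewrite Rs.
have xz : x != z by apply: contraNneq xzR => ->.
have zx : z != x by rewrite eq_sym.
pose row a := [set L a y | y in S & (a, y) \in R].
have lt_row a b : b \in S -> (a, b) \notin R -> #|row a| < #|S|.
  move=> bS abR; apply: leq_ltn_trans (leq_imset_card _ _) _.
  rewrite [X in _ < X](cardsD1 b) bS add1n ltnS; apply: subset_leq_card.
  apply/subsetP=> y; rewrite !inE => /andP[-> abR']; rewrite andbT.
  by apply: contraNneq abR => <-.
have [k0] : exists k, k \notin row x :|: row z.
  apply/existsP; rewrite -negb_forall; apply/negP=> /forallP all.
  have : #|V| <= #|row x :|: row z|.
    by rewrite -cardsT; apply/subset_leq_card/subsetP=> k _.
  have := lt_row x z zS xzR; have := lt_row z x xS zxR.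
  by rewrite cardsU; lia.
rewrite inE negb_or => /andP[k0x k0z].
pose new (p : V * V) := (p == (x, z)) || (p == (z, x)).
pose L1 a b := if new (a, b) then k0 else L a b.
pose R1 := R :|: [set (x, z); (z, x)].
have newC a b : new (a, b) = new (b, a).
  by rewrite /new !xpair_eqE orbC; congr (_ || _); rewrite andbC.
have R1E a b : ((a, b) \in R1) = ((a, b) \in R) || new (a, b) by rewrite !inE.
have newR p : new p -> p \notin R by case/orP=> /eqP->.
have newk a b : a \in S -> b \in S -> new (a, b) -> k0 \notin row a.
  by move=> aS bS; rewrite /new !xpair_eqE => /orP[]/andP[/eqP-> _].
have new_inj a b b' : new (a, b) -> new (a, b') -> b = b'.
  rewrite /new !xpair_eqE.
  move=> /orP[]/andP[/eqP-> /eqP->]; rewrite eqxx ?(negPf xz) ?(negPf zx) ?orbF.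
    by move=> /eqP->.
  by move=> /eqP->.
have [||||||L' [L'd L'inj L'sym L'odd]] := IHn R1 L1.
- apply: leq_trans len; apply: proper_card; apply/properP; split.
    by rewrite setDS // subsetUl.
  by exists (x, z); rewrite !inE /= ?xS ?zS ?eqxx ?(negPf xzR).
- by move=> a; rewrite inE Rd.
- by move=> a b; rewrite !R1E Rs newC.
- by move=> a b /RF abR; rewrite R1E abR.
- move=> a b b' aS bS b'S; rewrite !R1E /L1.
  have [nb|nb] := boolP (new (a, b)); have [nb'|nb'] := boolP (new (a, b')).
  + by move=> _ _ _; apply: new_inj nb nb'.
  + rewrite orbF => _ ab' e; have := newk _ _ aS bS nb.
    by rewrite e imset_f // inE b'S.
  + rewrite orbF => ab _ e; have := newk _ _ aS b'S nb'.
    by rewrite -e imset_f // inE bS.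
  + by rewrite !orbF; apply: Linj.
- move=> a b aS bS; rewrite R1E /L1 newC; case: ifP => // _.
  by rewrite orbF; apply: Lsym.
exists L'; split=> //.
  move=> a; rewrite L'd /L1 /new !xpair_eqE.
  by case: eqVneq => [->|_]; rewrite ?(negPf xz) //= andbC; case: eqVneq => // ->; rewrite (negPf zx).
move=> k; rewrite L'odd /occurrences.
pose old := [set p in setX S S | (p \in R) && (L p.1 p.2 == k)].
have old_new : old :&: [set (x, z); (z, x)] = set0.
  apply/eqP; rewrite setI_eq0 disjoints_subset; apply/subsetP=> p.
  by rewrite !inE => /and3P[_ pR _]; apply: contraL pR => /newR.
have -> : [set p in setX S S | (p \in R1) && (L1 p.1 p.2 == k)] =
          old :|: (if k0 == k then [set (x, z); (z, x)] else set0).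
  apply/setP=> -[a b]; rewrite in_setU in_set [(a, b) \in old]in_set in_setX /= R1E /L1.
  have [nab|nab] := boolP (new (a, b)).
    have -> : (a \in S) && (b \in S).
      by move: nab; rewrite /new !xpair_eqE => /orP[]/andP[/eqP-> /eqP->]; apply/andP.
    rewrite (negPf (newR _ nab)) /=.
    move: nab; rewrite /new !xpair_eqE => nab /=.
    by case: ifP; rewrite !inE ?xpair_eqE ?nab.
  move: nab; rewrite /new !xpair_eqE => /negPf nab; rewrite orbF.
  by case: ifP; rewrite !inE ?xpair_eqE ?nab ?orbF.
case: ifP => _; last by rewrite setU0.
by rewrite cardsU old_new cards0 subn0 cards2 xpair_eqE negb_and xz oddD addbF.
Qed.

(** Injectivity makes each row of [S] contain [k] exactly once or miss it. *)
Lemma occurrences_missing (V : finType) (S : {set V}) (L : V -> V -> V) k :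
  {in S, forall x, {in S &, injective (L x)}} ->
  occurrences S setT L k + missing S L k = #|S|.
Proof.
move=> Linj; rewrite /occurrences -sum1dep_card.
have -> : \sum_(p | (p \in setX S S) && ((p \in setT) && (L p.1 p.2 == k))) 1 =
          \sum_(x in S) \sum_(y in S | L x y == k) 1.
  by rewrite pair_big_dep /=; apply: eq_bigl => -[x y]; rewrite !inE /= andbA.
rewrite /missing -sum1dep_card [X in _ + X]big_mkcondr -big_split /= -sum1_card.
apply: eq_bigr => x xS; rewrite sum1dep_card.
have [/imsetP[y yS ->]|kL] := boolP (k \in L x @: S).
  rewrite addn0 -(cards1 y); apply: eq_card => y'; rewrite !inE.
  apply/andP/eqP => [[y'S /eqP]|->]; last by rewrite eqxx.
  exact: Linj.
rewrite (_ : [set _ | _] = set0) ?cards0 //; apply/setP=> y; rewrite !inE.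
by apply: contraNF kL => /andP[yS /eqP<-]; rewrite imset_f.
Qed.

(* The colours are the vertices themselves. The diagonal of the block is c, which
   identifies the two ends of every edge of M and fixes all other vertices; the
   entries at the ordered pairs (x, z) with F x z run bijectively over the
   vertices not covered by M (there are |V| - 2|M| = 2|E(F)| of them). *)
Lemma initial_block (V : finType) (F : sgraph V) (M : {set {set V}}) :
  matching F M -> 2 * #|edges F| + 2 * #|M| = #|V| ->
  2 * #|[set x | [exists y, F x y]]| <= #|V| ->
  exists S L W, partial_array F S L W.
Proof.
move=> matM cardV; set S := [set x | _] => leS.
have [/subsetP MF trivM] := andP matM.
have cardM := card_cover_matching matM.
pose D := [set p : V * V | F p.1 p.2].
have SF x y : F x y -> x \in S by move=> Fxy; rewrite inE; apply/existsP; exists y.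
have MS x : x \in cover M -> x \in S.
  case/bigcupP=> A AM xA.
  have /card_gt0P[y] : 0 < #|A :\ x|.
    by have := card_edge (MF A AM); rewrite (cardsD1 x) xA; lia.
  move=> /setD1P[yx yA]; apply: (SF x y).
  by apply: edge_adj (MF A AM) xA yA _; rewrite eq_sym.
(* The choice depends only on the block, so both ends of an edge of [M] get the same value; off the
   cover the block is empty and the default [x] applies. *)
pose c x := odflt x [pick z in pblock M x].
have c_id x : x \notin cover M -> c x = x.
  move=> xM; rewrite /c; case: pickP => //= z; rewrite /pblock.
  case: pickP => [A /andP[AM xA]|]; last by rewrite inE.
  by case/negP: xM; apply/bigcupP; exists A.
have c_block x : x \in cover M -> c x \in pblock M x.
  by move=> xM; rewrite /c; case: pickP => [z //|/(_ x)]; rewrite mem_pblock xM.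
have block_cover x y : x \in cover M -> y \in pblock M x -> y \in cover M.
  by move=> xM yx; apply/bigcupP; exists (pblock M x) => //; apply: pblock_mem.
have c_cover x : (c x \in cover M) = (x \in cover M).
  have [xM|xM] := boolP (x \in cover M); last by rewrite c_id // (negPf xM).
  by apply: block_cover (c_block x xM).
have block_c x y : x \in cover M -> y \in pblock M x -> c y = c x.
  move=> xM yx; rewrite /c (same_pblock trivM yx).
  by case: pickP => // /(_ y); rewrite yx.
pose f u := odflt u [pick y | F u y].
have fF u : u \in S -> F u (f u).
  by rewrite inE /f => /existsP[y Fuy]; case: pickP => [//|/(_ y)]; rewrite Fuy.
(* An uncovered [u] of [S] already stands on the diagonal of row [u], so its second occurrence goes
   to row [f u]. *)
pose B1 := [set (f u, u) | u in S :\: cover M].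
have cardB1 : #|B1| = #|S :\: cover M|.
  by apply: card_in_imset => u v _ _ [].
have B1D : B1 \subset D.
  by apply/subsetP=> _ /imsetP[u /setDP[uS _] ->]; rewrite inE /= adj_sym fF.
have MS' : cover M \subset S by apply/subsetP.
have cardD : #|D| = #|~: cover M|.
  by rewrite card_adj_pairs [RHS]cardsCs setCK cardM; lia.
(* The vertices outside [S] receive distinct remaining cells; they fit because [D] has as many
   elements as there are uncovered vertices. *)
have [|h [hinj hD]] := @inj_between V _ (fun x => (x, x)) (~: S) (D :\: B1).
  rewrite cardsD (setIidPr B1D) cardD cardB1 cardsD (setIidPr MS').
  rewrite [#|~: S|]cardsCs [#|~: cover M|]cardsCs !setCK.
  by have := subset_leq_card MS'; have := max_card [in S]; lia.
pose gam u := if u \in S then (f u, u) else h u.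
have gam_h u : u \notin S -> gam u \in D :\: B1.
  by move=> uS; rewrite /gam (negPf uS) hD // inE.
have gam_f u : u \in S -> gam u = (f u, u) by rewrite /gam => ->.
have gamB1 u : u \in S -> u \notin cover M -> gam u \in B1.
  by move=> uS uM; rewrite gam_f // imset_f // inE uM.
have gam_inj : {in ~: cover M &, injective gam}.
  move=> u v; rewrite !inE => uM vM.
  have [uS|uS] := boolP (u \in S); have [vS|vS] := boolP (v \in S).
  - by rewrite !gam_f // => -[].
  - by move=> e; have := gam_h v vS; rewrite -e inE gamB1.
  - by move=> e; have := gam_h u uS; rewrite e inE gamB1.
  - by rewrite /gam (negPf uS) (negPf vS); apply: hinj; rewrite inE.
have gamD u : u \notin cover M -> gam u \in D.
  move=> uM; have [uS|uS] := boolP (u \in S).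
    by apply: (subsetP B1D); apply: gamB1.
  by have /setDP[] := gam_h u uS.
have gam_im : gam @: (~: cover M) = D.
  apply/eqP; rewrite eqEcard card_in_imset // cardD leqnn andbT.
  by apply/subsetP=> _ /imsetP[u uM ->]; apply: gamD; rewrite inE in uM.
pose dc p := odflt p.1 [pick v | (v \notin cover M) && (gam v == p)].
have dcP p : p \in D -> dc p \notin cover M /\ gam (dc p) = p.
  rewrite -gam_im => /imsetP[v vM ->]; rewrite inE in vM.
  rewrite /dc; case: pickP => [w /andP[wM /eqP]//|/(_ v)].
  by rewrite vM eqxx.
have dc_gam v : v \notin cover M -> dc (gam v) = v.
  move=> vM; have [dM dg] := dcP _ (gamD v vM).
  by apply: gam_inj dg; rewrite inE.
(* A clash would make [x] uncovered with [c x = x], so the cell [(x, z)] would be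
   [gam x = (f x, x)], giving [f x = x]. *)
have dc_c x z : F x z -> dc (x, z) != c x.
  move=> Fxz; have xzD : (x, z) \in D by rewrite inE.
  have [dM dg] := dcP _ xzD; apply: contraNneq dM => e.
  rewrite e c_cover; apply: contraT => xM; move: dg.
  rewrite e c_id // gam_f ?(SF _ _ Fxz) // => -[fx _].
  by have := fF x (SF _ _ Fxz); rewrite fx adj_irr.
pose L0 x y := if x == y then c x else dc (x, y).
pose R0 := [set p : V * V | (p.1 == p.2) || F p.1 p.2].
have [|||||L [Ld Linj Lsym Lodd]] := @fill_block V F S R0 L0 leS.
- by move=> x; rewrite inE eqxx.
- by move=> x y; rewrite !inE /= adj_sym eq_sym.
- by move=> x y Fxy; rewrite inE /= Fxy orbT.
- move=> x y z xS yS zS; rewrite !inE /= /L0.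
  have [<-|xy] := eqVneq x y; have [<-|xz] := eqVneq x z => //=.
  + by move=> _ Fxz e; have := dc_c x z Fxz; rewrite e eqxx.
  + by move=> Fxy _ e; have := dc_c x y Fxy; rewrite e eqxx.
  + move=> Fxy Fxz e; have [|_ g1] := dcP (x, y); first by rewrite inE.
    have [|_ g2] := dcP (x, z); first by rewrite inE.
    by move: g1; rewrite e g2 => -[].
- move=> x y xS yS; rewrite inE /= /L0 => /orP[/eqP->//|Fxy].
  by rewrite Fxy.
have Lc x : L x x = c x by rewrite Ld /L0 eqxx.
(* A covered [k] occurs on the diagonal twice or never, an uncovered [k] of [S] exactly once. *)
have odd_diag k : odd #|[set x in S | c x == k]| = (k \in S) && (k \notin cover M).
  have [kM|kM] := boolP (k \in cover M); last first.
    rewrite andbT -[RHS]oddb; congr odd.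
    rewrite -[RHS](_ : #|[set x in S | x == k]| = _); last first.
      have [kS|kS] := boolP (k \in S).
        rewrite -[RHS](cards1 k); apply: eq_card => x; rewrite !inE.
        by apply: andb_idl => /eqP->; rewrite inE in kS.
      apply/eqP; rewrite cards_eq0; apply/eqP/setP=> x; rewrite in_set in_set0.
      by apply: contraNF kS => /andP[xS /eqP<-].
    apply: eq_card => x; rewrite !in_set; congr (_ && _).
    have [xM|xM] := boolP (x \in cover M); last by rewrite c_id.
    have /negPf-> : x != k by apply: contraNneq kM => <-.
    by apply/negbTE; apply: contraNneq kM => <-; rewrite c_cover.
  rewrite andbF.
  have [ck|ck] := eqVneq (c k) k.
    have -> : [set x in S | c x == k] = pblock M k.
      apply/setP=> x; rewrite [LHS]in_set; apply/andP/idP => [[xS /eqP cx]|xk].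
        have xM : x \in cover M by rewrite -c_cover cx.
        have := c_block x xM; rewrite cx => kx.
        by rewrite (same_pblock trivM kx) mem_pblock.
      split; first exact/MS/(block_cover k).
      by rewrite (block_c k) // ck.
    by rewrite (card_edge (MF _ (pblock_mem kM))).
  rewrite (_ : [set x in S | c x == k] = set0) ?cards0 //.
  apply/setP=> x; rewrite [LHS]in_set in_set0; apply/negbTE.
  apply: contra ck => /andP[xS /eqP cx].
  have xM : x \in cover M by rewrite -c_cover cx.
  by have := c_block x xM; rewrite cx => kx; rewrite (block_c x) // cx.
have occE k : occurrences S R0 L0 k =
    #|[set x in S | c x == k]| + (k \notin cover M).
  rewrite /occurrences.
  pose diag := [set (x, x) | x in [set x in S | c x == k]].
  pose darts := [set p in D | dc p == k].
  have -> : [set p in setX S S | (p \in R0) && (L0 p.1 p.2 == k)] = diag :|: darts.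
    apply/setP=> -[x y]; rewrite in_setU [LHS]in_set in_setX [_ \in R0]in_set.
    rewrite [_ \in darts]in_set [_ \in D]in_set /= /L0.
    have [<-|xy] := eqVneq x y.
      rewrite adj_irr andbb /= orbF; apply/idP/imsetP => [xS|[z]].
        by exists x; rewrite // [_ \in finset _]in_set.
      by rewrite [_ \in finset _]in_set => zS [->].
    rewrite (_ : (x, y) \in diag = false) /=; last first.
      by apply: contraNF xy => /imsetP[z _ [-> ->]].
    have [Fxy|//] := boolP (F x y); last by rewrite andbF.
    by rewrite (SF _ _ Fxy) (SF y x) // adj_sym.
  have d0 : diag :&: darts = set0.
    apply/eqP; rewrite setI_eq0 disjoints_subset; apply/subsetP=> _ /imsetP[x _ ->].
    by rewrite !inE /= adj_irr.
  rewrite cardsU d0 cards0 subn0 card_imset; last by move=> x y [].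
  congr (_ + _); have [kM|kM] := boolP (k \in cover M).
    rewrite (_ : darts = set0) ?cards0 //; apply/setP=> p; rewrite in_set in_set0.
    apply/negbTE/negP=> /andP[/dcP[dM _] /eqP dk].
    by rewrite dk kM in dM.
  rewrite (_ : darts = [set gam k]) ?cards1 //; apply/setP=> p.
  rewrite in_set in_set1; apply/andP/eqP => [[/dcP[_ g] /eqP<-]//|->].
  by rewrite gamD // dc_gam.
(* An uncovered [k] of [S] has one diagonal and one off-diagonal entry; a covered one has only its
   even diagonal count; a [k] outside [S] has a single entry. The odd symbols are thus those outside
   [S], which is why [W] is [~: S]. *)
have odd_occ k : odd (occurrences S setT L k) = (k \notin S).
  rewrite Lodd occE oddD odd_diag oddb.
  have [kM|kM] := boolP (k \in cover M); first by rewrite andbF MS.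
  by rewrite andbT; case: (k \in S).
exists S, L, (~: S); split=> //.
- move=> x y xS yS xy; rewrite !Lc; apply: contraNneq => e.
  have [xM|xM] := boolP (x \in cover M); last first.
    move: e; rewrite c_id // => e; move: xy; rewrite e.
    have /c_id-> : y \notin cover M by rewrite -c_cover -e.
    by rewrite eqxx.
  have yM : y \in cover M by rewrite -c_cover -e c_cover.
  have := c_block y yM; rewrite -e => /(same_pblock trivM) exy.
  have := c_block x xM => /(same_pblock trivM) exx.
  apply: edge_adj (MF _ (pblock_mem xM)) _ _ xy; first by rewrite mem_pblock.
  by rewrite -exx exy mem_pblock.
- move=> x xS; rewrite in_setC negbK Lc.
  have [xM|xM] := boolP (x \in cover M); last by rewrite c_id.
  by apply: MS; rewrite c_cover.
have cS : #|~: S| + #|S| = #|V| by rewrite addnC cardsC.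
(* The parity holds since [#|V|] is even by [cardV]. The bound holds since [#|S| <= #|~: S|] and,
   for [k] outside [S], an odd number of occurrences means that some row has [k]. *)
split=> // k; have := odd_occ k; have := occurrences_missing k Linj.
by rewrite in_setC; lia.
Qed.

(** * Total colourings *)

(** Edge colours are indexed by ordered pairs and constrained only on adjacent ones, so that an
    array can be read directly as a colouring. *)
Definition total_coloring (V C : finType) (G : sgraph V) (cv : V -> C)
    (ce : V -> V -> C) : Prop :=
  [/\ forall x y, G x y -> cv x != cv y,
      forall x y, G x y -> ce x y = ce y x,
      forall x y, G x y -> cv x != ce x y &
      forall x y z, G x y -> G x z -> y != z -> ce x y != ce x z].

Lemma total_colorable_coloring (V : finType) (G : sgraph V) k :
  total_colorable G k ->
  exists (cv : V -> 'I_k) (ce : V -> V -> 'I_k), total_coloring G cv ce.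
Proof.
case/existsP=> c /forallP cP.
have {}cP a b : conflict a b -> c a != c b.
  by move=> ab; apply: (implyP (forallP (cP a) b)).
pose e x y : option {A | A \in edges G} := insub [set x; y].
(* Off the edges the value is arbitrary; [c (inl x)] is at hand even though ['I_k] is not known to
   be inhabited. *)
pose ce x y := if e x y is Some A then c (inr A) else c (inl x).
have ceE x y : G x y -> exists2 A : {A | A \in edges G}, val A = [set x; y] & ce x y = c (inr A).
  rewrite -mem_edges => xy; exists (exist (fun A => A \in edges G) _ xy) => //.
  by rewrite /ce /e insubT.
exists (fun x => c (inl x)), ce; split.
- by move=> x y Gxy; apply: cP.
- move=> x y Gxy; rewrite /ce /e setUC.
  by case: insubP => //; rewrite setUC mem_edges Gxy.
- move=> x y /ceE[A Axy ->]; apply: cP => /=.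
  by rewrite Axy !inE eqxx.
- move=> x y z Gxy Gxz yz.
  have [A Axy ->] := ceE x y Gxy; have [B Bxz ->] := ceE x z Gxz.
  apply: cP => /=; apply/andP; split.
    rewrite -(inj_eq val_inj) Axy Bxz set2_eq eqxx /= (negPf yz) /=.
    by rewrite negb_and (adj_neq Gxz).
  by apply/pred0Pn; exists x; rewrite /= Axy Bxz !inE eqxx.
Qed.

Lemma total_coloring_colorable (V C : finType) (G : sgraph V) (cv : V -> C)
    (ce : V -> V -> C) k :
  total_coloring G cv ce -> #|C| <= k -> total_colorable G k.
Proof.
move=> [cvP cesym cvce ceP] leC.
have ends (A : {A | A \in edges G}) :
    exists p : V * V, G p.1 p.2 && (val A == [set p.1; p.2]).
  have /edgesP[x [y [Gxy e]]] := valP A.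
  by exists (x, y); rewrite /= Gxy; apply/eqP.
pose col (t : total_element G) : C :=
  match t with inl x => cv x | inr A => let p := xchoose (ends A) in ce p.1 p.2 end.
have colE A x y : G x y -> val A = [set x; y] -> col (inr A) = ce x y.
  move=> Gxy Axy; rewrite /col; set p := xchoose _.
  have /andP[_] := xchooseP (ends A); rewrite -/p Axy set2_eq.
  by case/orP=> /andP[/eqP <- /eqP <-] //; rewrite [RHS]cesym.
have endsP (A : {A | A \in edges G}) x : x \in val A ->
    exists2 y, G x y & val A = [set x; y].
  have /edgesP[a [b [Gab e]]] := valP A; rewrite /= in e *.
  rewrite e !inE => /orP[]/eqP->; first by exists b.
  by exists a; rewrite 1?adj_sym // setUC.
apply/existsP; exists [ffun t => widen_ord leC (enum_rank (col t))].
apply/forallP=> a; apply/forallP=> b; apply/implyP=> cab; rewrite !ffunE.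
have : col a != col b.
  case: a b cab => [x|A] [y|B] /=; first exact: cvP.
  - move=> /endsP[y Gxy e]; rewrite -/(col (inr B)) (colE B x y) //; exact: cvce.
  - move=> /endsP[z Gxy e]; rewrite -/(col (inr A)) (colE A y z) // eq_sym; exact: cvce.
  - case/andP=> AB /pred0Pn[x /andP[/= /endsP[y Gxy eA] /endsP[z Gxz eB]]].
    rewrite -/(col (inr A)) -/(col (inr B)) (colE A x y) // (colE B x z) //.
    apply: ceP => //; apply: contraNneq AB => yz.
    by apply/eqP/val_inj; rewrite eA yz -eB.
apply: contraNneq => /(congr1 val) /= /val_inj/enum_rank_inj->.
by [].
Qed.

Lemma total_colorable_leq (V : finType) (G : sgraph V) k k' :
  k <= k' -> total_colorable G k -> total_colorable G k'.
Proof.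
move=> kk' /total_colorable_coloring[cv [ce cP]].
by apply: total_coloring_colorable cP _; rewrite card_ord.
Qed.

Lemma total_colorable_embed (U V : finType) (G : sgraph U) (G' : sgraph V)
    (f : U -> V) k :
  injective f -> (forall x y, G x y -> G' (f x) (f y)) ->
  total_colorable G' k -> total_colorable G k.
Proof.
move=> finj fG /total_colorable_coloring[cv [ce [c1 c2 c3 c4]]].
apply: (@total_coloring_colorable _ _ G (cv \o f) (fun x y => ce (f x) (f y))).
  split=> [x y /fG/c1|x y /fG/c2|x y /fG/c3|x y z /fG xy /fG xz yz] //.
  by apply: c4; rewrite ?(inj_eq finj).
by rewrite card_ord.
Qed.

(** Injectivity of row [x] separates the edges at [x] from each other and from the diagonal entry,
    which colours [x]. *)
Lemma array_colorable (V : finType) (F : rel V) (G : sgraph V) L W :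
  partial_array F [set: V] L W -> (forall x y, G x y -> ~~ F x y) ->
  total_colorable G #|V|.
Proof.
move=> [Linj Lsym Ldiag _ _] GF.
apply: (@total_coloring_colorable _ _ G (fun x => L x x) L _ _ (leqnn _)); split.
- by move=> x y Gxy; apply: Ldiag; rewrite ?inE ?GF // (adj_neq Gxy).
- by move=> x y Gxy; apply: Lsym; rewrite ?inE ?GF.
- move=> x y Gxy; apply: contraNneq (adj_neq Gxy) => /Linj.
  by rewrite !inE => /(_ isT isT isT)->.
- move=> x y z _ _; apply: contraNneq => /Linj.
  by rewrite !inE => /(_ isT isT isT)->.
Qed.

(** Number the vertices and colour edges by sums modulo [N], vertices by doubles: doubling is
    injective modulo an odd number. *)
Lemma total_colorable_odd (V : finType) (G : sgraph V) N :
  odd N -> #|V| <= N -> total_colorable G N.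
Proof.
move=> oddN leN; have N0 : 0 < N by case: N oddN {leN}.
pose r (x : V) : nat := enum_rank x.
have rN x : r x < N by apply: leq_trans leN; apply: ltn_ord.
have r_inj x y : r x = r y -> x = y by move=> /val_inj/enum_rank_inj.
pose L x y : 'I_N := Ordinal (ltn_pmod (r x + r y) N0).
have Linj x y z : L x y = L x z -> y = z.
  move=> /(congr1 val) /= /eqP; rewrite eqn_modDl !modn_small // => /eqP.
  exact: r_inj.
have Lsym x y : L x y = L y x by apply: val_inj; rewrite /= addnC.
have Ldiag x y : L x x = L y y -> x = y.
  move=> /(congr1 val) /=; rewrite !addnn -!mul2n.
  wlog le_xy : x y / r x <= r y => [hw|].
    have [/hw//|/ltnW yx e] := leqP (r x) (r y).
    by apply/esym/hw.
  move/esym/eqP; rewrite eqn_mod_dvd; last by rewrite leq_mul2l le_xy.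
  rewrite -mulnBr Gauss_dvdr; last by rewrite coprime_sym coprime2n.
  have [e _|lt] := posnP (r y - r x).
    by apply: r_inj; apply/eqP; rewrite eqn_leq le_xy -subn_eq0 e.
  by move=> /(dvdn_leq lt); have := rN y; lia.
apply: (@total_coloring_colorable _ _ G (fun x => L x x) L); last by rewrite card_ord.
split=> [x y /adj_neq xy|//|x y /adj_neq xy|x y z _ _].
- by apply: contraNneq xy => /Ldiag->.
- by apply: contraNneq xy => /Linj->.
- by apply: contraNneq => /Linj->.
Qed.

(** * Hilton's theorem *)

Lemma edge_graph_sym (V : finType) (E : {set {set V}}) :
  symmetric (fun x y : V => (x != y) && ([set x; y] \in E)).
Proof. by move=> x y; rewrite eq_sym setUC. Qed.

Lemma edge_graph_irr (V : finType) (E : {set {set V}}) :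
  irreflexive (fun x y : V => (x != y) && ([set x; y] \in E)).
Proof. by move=> x; rewrite eqxx. Qed.

Definition edge_graph (V : finType) (E : {set {set V}}) : sgraph V :=
  SGraph (@edge_graph_sym V E) (@edge_graph_irr V E).

Lemma edges_edge_graph (V : finType) (E : {set {set V}}) :
  {in E, forall A : {set V}, #|A| = 2} -> edges (edge_graph E) = E.
Proof.
move=> E2; apply/setP=> A; apply/edgesP/idP => [[x [y [/andP[_ xyE] ->]]]//|AE].
have /eqP/cards2P[x [y [xy e]]] := E2 A AE.
by exists x, y; split=> //=; rewrite xy -e.
Qed.

(** The line graph of [J] has diameter at most 2; [C] may be [A] or [B] itself. *)
Definition linked_edges (V : finType) (J : sgraph V) : Prop :=
  {in edges J &, forall A B : {set V}, exists C : {set V},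
     [/\ C \in edges J, ~~ [disjoint C & A] & ~~ [disjoint C & B]]}.

(** [F] grows by one edge at a time, each after the first meeting the vertices already covered and
    so adding at most one. *)
Lemma linked_edges_subset (V : finType) (J : sgraph V) k :
  linked_edges J ->
  k <= #|edges J| ->
  exists F : {set {set V}}, [/\ F \subset edges J, #|F| = k & #|cover F| <= k.+1].
Proof.
move=> Jconn; elim: k => [_|k IHk lek].
  by exists set0; rewrite sub0set cards0 /cover big_set0 cards0.
have [F [FJ cF covF]] := IHk (ltnW lek).
have cover1 D : cover (D |: F) = D :|: cover F.
  by rewrite /cover bigcup_setU big_set1.
suff [D [DJ DF leD]] : exists D : {set V}, [/\ D \in edges J, D \notin F & #|cover (D |: F)| <= k.+2].
  by exists (D |: F); rewrite subUset sub1set DJ FJ cardsU1 DF cF.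
have /card_gt0P[B /setDP[BJ BF]] : 0 < #|edges J :\: F|.
  by rewrite cardsD (setIidPr FJ) cF subn_gt0.
have meet D : D \in edges J -> ~~ [disjoint D & cover F] -> #|cover (D |: F)| <= k.+2.
  move=> DJ; rewrite -setI_eq0 -card_gt0 cover1 cardsU (card_edge DJ); lia.
have [F0|/set0Pn[A AF]] := eqVneq F set0.
  exists B; split=> //; rewrite cover1 F0 /cover big_set0 setU0 (card_edge BJ).
  by move: cF; rewrite F0 cards0 => <-.
have AJ := subsetP FJ A AF.
have [dBF|mBF] := boolP [disjoint B & cover F]; last first.
  by exists B; split=> //; apply: meet.
have [C [CJ CA CB]] := Jconn A B AJ BJ.
have subcov D : D \in F -> D \subset cover F by move=> DF; apply: bigcup_sup.
(* [B] is disjoint from the cover, so an edge linking [A] to [B] meets the cover and, since it meets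
   [B], is not in [F]. *)
exists C; split=> //.
  apply: contra CB => CF; rewrite disjoint_sym.
  exact: disjointWr (subcov C CF) dBF.
by apply: meet => //; apply: contra CA => /(disjointWr (subcov A AF)).
Qed.

Lemma matching_numberP (V : finType) (J : sgraph V) :
  exists2 M, matching J M & #|M| = matching_number J.
Proof.
have m0 : matching J set0.
  by rewrite /matching sub0set; apply/trivIsetP=> A B; rewrite inE.
have [|M matM eM] := @eq_bigmax_cond _ (matching J) (fun M : {set {set V}} => #|M|).
  by apply/card_gt0P; exists set0.
by exists M => //; apply/esym.
Qed.

Lemma leq_matching_number (V : finType) (J : sgraph V) M :
  matching J M -> #|M| <= matching_number J.
Proof. by move=> matM; apply: (@leq_bigmax_cond _ _ (fun M : {set {set V}} => #|M|)). Qed.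

Lemma subset_of_card (T : finType) (A : {set T}) m :
  m <= #|A| -> exists2 B : {set T}, B \subset A & #|B| = m.
Proof.
move=> leA; exists [set x in take m (enum A)].
  by apply/subsetP=> x; rewrite inE => /mem_take; rewrite mem_enum.
rewrite cardsE (card_uniqP _) ?take_uniq ?enum_uniq // size_take -cardE.
by case: ltngtP leA.
Qed.

Lemma matching_sub (V : finType) (J J' : sgraph V) (M M' : {set {set V}}) :
  matching J M -> M' \subset M -> M' \subset edges J' -> matching J' M'.
Proof.
move=> /andP[_ trivM] M'M M'J; rewrite /matching M'J; apply/trivIsetP=> A B AM BM.
by apply: (trivIsetP trivM); apply: (subsetP M'M).
Qed.

Theorem hilton_sufficient (V : finType) (G J : sgraph V) :
  (forall x y, G x y -> ~~ J x y) ->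
  linked_edges J ->
  ~~ odd #|V| -> 2 < #|V| ->
  #|V| <= 2 * (#|edges J| + matching_number J) ->
  total_colorable G #|V|.
Proof.
move=> GJ Jconn evenV V2 leV.
pose n := #|V|./2; have Vn : #|V| = 2 * n by rewrite /n; lia.
(* The cap [n - 1] keeps the [k + 1] vertices that [F] may cover within half of [V]. *)
pose k := minn #|edges J| n.-1.
have [F [FJ cF covF]] := linked_edges_subset Jconn (geq_minl _ _ : k <= _).
have F2 : {in F, forall A : {set V}, #|A| = 2} by move=> A AF; apply/card_edge/(subsetP FJ).
have [M0 matM0 cM0] := matching_numberP J.
suff [M [MF matM cM]] : exists M : {set {set V}}, [/\ M \subset F, matching J M & #|M| = n - k].
  have [|||S [L [W pa]]] := @initial_block V (edge_graph F) M.
  - by apply: matching_sub matM (subxx _) _; rewrite edges_edge_graph.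
  - by rewrite edges_edge_graph // cF cM; lia.
  - apply: (@leq_trans (2 * #|cover F|)).
      rewrite leq_mul2l; apply/subset_leq_card/subsetP=> x.
      rewrite inE => /existsP[y /= /andP[_ xyF]].
      by apply/bigcupP; exists [set x; y]; rewrite // !inE eqxx.
    by rewrite Vn leq_mul2l; lia.
  have [L' [W' pa']] := extend_array pa.
  apply: array_colorable pa' _ => x y /GJ; apply: contra => /andP[_ xyF].
  by rewrite -mem_edges (subsetP FJ).
(* If the cap is not exceeded, [F] is all of [J] and [M] is cut out of a maximum matching, large
   enough by [leV]. *)
have [le|lt] := leqP #|edges J| n.-1.
  have [|M MM0 cM] := @subset_of_card _ M0 (n - k); first by lia.
  have matM : matching J M.
    by apply: (matching_sub matM0 MM0); apply: subset_trans MM0 _; case/andP: matM0.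
  have FE : F = edges J by apply/eqP; rewrite eqEcard FJ cF /k; lia.
  by exists M; rewrite FE; case/andP: (matM).
(* Now [n - k = 1], so one edge of [F] suffices; [F] is nonempty because [n] is at least 2. *)
have /card_gt0P[A AF] : 0 < #|F| by rewrite cF /k; lia.
exists [set A]; rewrite sub1set AF cards1; split=> //; last by rewrite /k; lia.
rewrite /matching sub1set (subsetP FJ) //=.
by apply/trivIsetP=> B C /set1P-> /set1P->; rewrite eqxx.
Qed.

(** Removing two vertices of one colour preserves the parity of every class; when no such pair is
    left, each remaining vertex is alone in its class and accounts for one odd class. *)
Lemma monochromatic_pairs (V C : finType) (f : V -> C) (A : {set V}) :
  exists M : {set {set V}},
    [/\ trivIset M, cover M \subset A,
        {in M, forall B : {set V}, exists x y, [/\ x != y, f x = f y & B = [set x; y]]} &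
        #|A| <= 2 * #|M| + #|[set k | odd #|[set x in A | f x == k]|]|].
Proof.
have [n] := ubnP #|A|; elim: n => // n IHn in A *; rewrite ltnS => leA.
have [/existsP[x /existsP[y /and4P[xA yA xy /eqP fxy]]]|noxy] := boolP
    [exists x, exists y, [&& x \in A, y \in A, x != y & f x == f y]].
  pose A' := A :\ x :\ y.
  have cA : #|A| = #|A'|.+2.
    by rewrite (cardsD1 x) xA (cardsD1 y (A :\ x)) !inE eq_sym xy yA.
  have [|M [trivM covM monoM leM]] := IHn A'; first by lia.
  have xyM : {in M, forall B : {set V}, [disjoint [set x; y] & B]}.
    move=> B BM; rewrite disjoint_sym disjoints_subset.
    apply: subset_trans (subset_trans (bigcup_sup B BM) covM) _.
    by apply/subsetP=> z; rewrite !inE negb_or => /and3P[-> ->].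
  have xyNM : [set x; y] \notin M.
    apply/negP=> /xyM; rewrite -setI_eq0 setIid => /eqP/setP/(_ x).
    by rewrite !inE eqxx.
  exists ([set x; y] |: M); split.
  - apply/trivIsetP=> B D /setU1P[->|BM] /setU1P[->|DM] // BD.
    + by rewrite eqxx in BD.
    + exact: xyM.
    + by rewrite disjoint_sym xyM.
    + by apply: (trivIsetP trivM).
  - rewrite /cover bigcup_setU big_set1 -/(cover M); apply/subUsetP; split.
      by apply/subsetP=> z; rewrite !inE => /orP[]/eqP->.
    by apply: subset_trans covM _; apply/subsetP=> z; rewrite !inE => /and3P[].
  - by move=> B /setU1P[->|/monoM//]; exists x, y.
  rewrite cardsU1 xyNM cA.
  suff -> : [set k | odd #|[set x in A | f x == k]|] =
            [set k | odd #|[set x in A' | f x == k]|] by lia.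
  apply/setP=> k; rewrite !inE.
  have [fk|fk] := eqVneq (f x) k.
    rewrite (cardsD1 x) !inE xA fk eqxx (cardsD1 y) !inE eq_sym xy yA -fxy fk eqxx /=.
    rewrite negbK; congr (odd _); apply: eq_card => z; rewrite !inE.
    by rewrite -!andbA.
  congr (odd _); apply: eq_card => z; rewrite !inE.
  have [->|zy] := eqVneq z y; first by rewrite -fxy (negPf fk) andbF.
  by have [->|zx] := eqVneq z x; first by rewrite (negPf fk) andbF.
exists set0; split.
- by apply/trivIsetP=> B; rewrite inE.
- by rewrite /cover big_set0 sub0set.
- by move=> B; rewrite inE.
have finj : {in A &, injective f}.
  move=> x y xA yA fxy; apply/eqP; apply: contraNT noxy => xy.
  by apply/existsP; exists x; apply/existsP; exists y; rewrite xA yA xy fxy eqxx.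
rewrite cards0 muln0 add0n -(card_in_imset finj); apply/subset_leq_card/subsetP.
move=> _ /imsetP[x xA ->]; rewrite inE (_ : [set _ | _] = [set x]) ?cards1 //.
apply/setP=> y; rewrite !inE; apply/andP/eqP => [[yA /eqP]|->]; last by rewrite xA eqxx.
by move/finj; apply.
Qed.

Lemma card_adj_compl (V : finType) (G : sgraph V) :
  #|[set p : V * V | G p.1 p.2]| + #|[set p : V * V | compl G p.1 p.2]| + #|V| =
  #|V| * #|V|.
Proof.
rewrite -card_prod -[X in _ = X]cardsT.
pose diag := [set (x, x) | x in [set: V]].
have <- : #|diag| = #|V| by rewrite card_imset ?cardsT // => x y [].
have diagE x y : ((x, y) \in diag) = (x == y).
  by apply/imsetP/eqP => [[z _ [-> ->]]|->] //; exists y.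
pose E := [set p : V * V | G p.1 p.2]; pose E' := [set p : V * V | compl G p.1 p.2].
have d1 : E :&: E' = set0.
  by apply/setP=> -[x y]; rewrite !inE /=; case: (G x y); rewrite ?andbF.
have d2 : (E :|: E') :&: diag = set0.
  apply/setP=> -[x y]; rewrite in_setI diagE !inE /=.
  by have [->|] := eqVneq x y; rewrite ?adj_irr ?andbF.
have -> : [set: V * V] = E :|: E' :|: diag.
  apply/setP=> -[x y]; rewrite in_setU diagE !inE /=.
  by case: (G x y) => //=; case: eqVneq.
by rewrite cardsU d2 cards0 subn0 cardsU d1 cards0 subn0.
Qed.

(* The number of vertices missing a colour has the parity of the number of vertices
   having it, as |V| is even, so every odd class costs a missing vertex. *)
Theorem hilton_necessary (V : finType) (G : sgraph V) N :
  ~~ odd #|V| -> total_colorable G N -> N = #|V| ->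
  N <= 2 * (#|edges (compl G)| + matching_number (compl G)).
Proof.
move=> evenV /total_colorable_coloring[cv [ce [c1 c2 c3 c4]]] NV.
pose s k := #|[set x | cv x == k]|.
pose E k := [set p : V * V | G p.1 p.2 && (ce p.1 p.2 == k)].
have sum_s : \sum_k s k = #|V|.
  rewrite -sum1_card (partition_big cv predT) //=; apply: eq_bigr => k _.
  by rewrite sum1dep_card.
have sum_E : \sum_k #|E k| = #|[set p : V * V | G p.1 p.2]|.
  rewrite -sum1_card (partition_big (fun p => ce p.1 p.2) predT) //=.
  by apply: eq_bigr => k _; rewrite sum1dep_card; apply: eq_card => p; rewrite !inE.
have even_E k : ~~ odd #|E k|.
  pose adjk x y := G x y && (ce x y == k).
  have sym : symmetric adjk.
    move=> x y; rewrite /adjk [G y x]adj_sym; apply: andb_id2l => Gxy.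
    by rewrite c2.
  have irr : irreflexive adjk by move=> x; rewrite /adjk adj_irr.
  by rewrite (card_adj_pairs (SGraph sym irr)) oddM.
(* The vertices coloured [k] and the ends of edges coloured [k] are all distinct. Since [#|V|] and
   [#|E k|] are even, an odd [s k] leaves room for one more. *)
have le_class k : s k + #|E k| + odd (s k) <= #|V|.
  suff : s k + #|E k| <= #|V| by move: (even_E k); lia.
  have fst_inj : {in E k &, injective (fun p : V * V => p.1)}.
    move=> [x y] [x' z]; rewrite !inE /= => /andP[Gxy /eqP cy] /andP[Gxz /eqP cz] e.
    rewrite -e in Gxz cz *; congr (_, _); apply/eqP; apply: contraT => yz.
    by have := c4 x y z Gxy Gxz yz; rewrite cy cz eqxx.
  rewrite /s -(card_in_imset fst_inj).
  set B := imset _ _; have d : [set x | cv x == k] :&: B = set0.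
    apply/eqP; rewrite setI_eq0 disjoint_sym disjoints_subset.
    apply/subsetP=> _ /imsetP[[x y] /[!inE] /= /andP[Gxy /eqP <-] ->].
    exact: c3.
  have := max_card [in [set x | cv x == k] :|: B].
  by rewrite cardsU d cards0 subn0.
(* Sum [le_class] over the [N = #|V|] colours and compare with the number of ordered pairs. *)
have le_odd : #|[set k | odd (s k)]| <= 2 * #|edges (compl G)|.
  have : \sum_k (s k + #|E k| + odd (s k)) <= #|V| * #|V|.
    apply: (@leq_trans (\sum_(k < N) #|V|)); first by apply: leq_sum.
    by rewrite sum_nat_const card_ord NV.
  rewrite !big_split /= sum_s sum_E sum_bool_card -card_adj_pairs.
  have -> : #|[set k | predT k && odd (s k)]| = #|[set k | odd (s k)]| by [].
  have := card_adj_compl G.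
  move: (#|V| * #|V|) #|V| #|[set p : V * V | G _ _]| #|[set p : V * V | compl G _ _]|
    #|[set k | odd (s k)]| => v2 v b c o; lia.
(* Vertices of equal colour are nonadjacent, so the monochromatic pairs form a matching of the
   complement. *)
have [M [trivM _ monoM]] := monochromatic_pairs cv [set: V].
have matM : matching (compl G) M.
  rewrite /matching trivM andbT; apply/subsetP=> B /monoM[x [y [xy cxy ->]]].
  rewrite mem_edges /= xy; apply/negP=> /c1.
  by rewrite cxy eqxx.
rewrite cardsT -NV.
have -> : [set k | odd #|[set x in [set: V] | cv x == k]|] = [set k | odd (s k)].
  by apply/setP=> k; rewrite !inE; congr odd; apply: eq_card => x; rewrite !inE.
by have := leq_matching_number matM; lia.
Qed.

(** * Split graphs of stretch index 2 *)

(** With [2 < #|V|] the bound excludes the junk value [#|V|] of [dist], so an actual walk of length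
    1 or 2 exists. *)
Lemma dist_leq2 (V : finType) (T : sgraph V) u w :
  2 < #|V| -> u != w -> dist T u w <= 2 -> T u w \/ exists z, T u z /\ T z w.
Proof.
move=> V2 uw; rewrite /dist; set P := (fun n : nat => _) => le2.
have : has P (iota 0 #|V|) by rewrite has_find size_iota; apply: leq_ltn_trans V2.
move/(nth_find 0); rewrite nth_iota; last exact: leq_ltn_trans V2.
rewrite add0n; move: (find _ _) le2 => d le2 /existsP[[p /= /eqP sp]].
rewrite -{}sp in le2; case: p le2 => [|a [|b [|//]]] _ /=.
- by rewrite (negPf uw).
- by rewrite andbT => /andP[ua /eqP <-]; left.
- by rewrite andbT => /andP[/andP[ua ab] /eqP <-]; right; exists a.
Qed.

Lemma dist_adj (V : finType) (T : sgraph V) u w : T u w -> dist T u w <= 1.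
Proof.
move=> Tuw; rewrite /dist leqNgt; apply/negP=> lt1.
have V2 : 1 < #|V|.
  by apply/card_gt1P; exists u, w; split=> //; apply: adj_neq Tuw.
have := before_find 0 lt1; rewrite nth_iota // add0n => /existsP[].
by exists [tuple w]; rewrite /= Tuw eqxx.
Qed.

Lemma acyclic_cycle (V : finType) (T : sgraph V) s :
  acyclic T -> cycle T s -> uniq s -> size s <= 2.
Proof. by move=> acT cyc un; apply: acT; rewrite /ucycle cyc. Qed.

Lemma ucycle_neighbours (V : finType) (G : sgraph V) s x :
  ucycle G s -> 2 < size s -> x \in s -> exists y z, [/\ y != z, G x y & G x z].
Proof.
move=> cyc s3 xs; have [i s' es] := rot_to xs.
have : cycle G (x :: s') && uniq (x :: s') by rewrite -es rot_cycle rot_uniq.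
move=> /andP[].
have : 2 < size (x :: s') by rewrite -es size_rot.
case: s' {es} => [|y [|z t]] //= _ /andP[Gxy].
rewrite rcons_path => /andP[_ /andP[_ Gz]] /and3P[_ yzs _].
exists y, (last z t); split=> //; last by rewrite adj_sym.
by apply: contraNneq yzs => ->; apply: mem_last.
Qed.

(** Some two vertices of [X] are nonadjacent, since [T] has no triangle. Their midpoint is the
    centre: a vertex of [X] not joined to it would close a cycle through both of them. *)
Lemma star_center (V : finType) (T : sgraph V) (X : {set V}) :
  acyclic T -> 2 < #|X| ->
  {in X &, forall x y, x != y -> T x y \/ exists z, T x z /\ T z y} ->
  exists z, {in X, forall x, x != z -> T z x}.
Proof.
move=> acT X3 near2.
have cyc s : cycle T s -> uniq s -> 2 < size s -> False.
  by move=> cs us; rewrite ltnNge (acyclic_cycle acT cs us).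
have neq x y : T x y -> (x == y) = false by move/adj_neq/negPf.
have [u [w [uX wX uw Nuw]]] : exists u w, [/\ u \in X, w \in X, u != w & ~~ T u w].
  have /card_gt2P[a [b [c [[aX bX cX] [ab bc ca]]]]] := X3.
  have [Tab|] := boolP (T a b); last by exists a, b.
  have [Tbc|] := boolP (T b c); last by exists b, c.
  have [Tca|] := boolP (T c a); last by exists c, a.
  case: (cyc [:: a; b; c]) => //=; first by rewrite Tab Tbc Tca.
  by rewrite !inE negb_or ab bc eq_sym ca.
have [Tuw|[z [Tuz Tzw]]] := near2 u w uX wX uw; first by rewrite Tuw in Nuw.
exists z => x xX xz; apply: contraT => Nzx.
have xu : x != u by apply: contraNneq Nzx => ->; rewrite adj_sym.
have xw : x != w by apply: contraNneq Nzx => ->.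
have Twz : T w z by rewrite adj_sym.
have Tzu : T z u by rewrite adj_sym.
have Nxz : ~~ T x z by rewrite adj_sym.
have Nwu : ~~ T w u by rewrite adj_sym.
(* According to the lengths of the walks from [x] to [u] and [w], the cycle has length 4, 5 or 6; if
   both midpoints coincide it is the 4-cycle avoiding [x]. *)
have [Txu|[a [Txa Tau]]] := near2 x u xX uX xu;
  have [Txw|[b [Txb Tbw]]] := near2 x w xX wX xw.
- case: (cyc [:: x; u; z; w]) => //=; first by rewrite Txu Tuz Tzw adj_sym Txw.
  by rewrite !inE !negb_or xu xz xw uw !(neq _ _ Tuz) !(neq _ _ Tzw).
- have bz : z != b by apply: contraNneq Nxz => ->.
  have bu : u != b by apply: contraNneq Nuw => ->.
  case: (cyc [:: x; u; z; w; b]) => //=.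
    by rewrite Txu Tuz Tzw adj_sym Tbw adj_sym Txb.
  rewrite !inE !negb_or xu xz xw uw bz bu (neq _ _ Txb) (neq _ _ Tuz) (neq _ _ Tzw).
  by rewrite eq_sym (neq _ _ Tbw).
- have az : z != a by apply: contraNneq Nxz => ->.
  have aw : w != a by apply: contraNneq Nwu => ->.
  case: (cyc [:: x; w; z; u; a]) => //=.
    by rewrite Txw Twz Tzu adj_sym Tau adj_sym Txa.
  rewrite !inE !negb_or xu xz xw az aw [w == u]eq_sym uw.
  rewrite (neq _ _ Txa) (neq _ _ Twz) (neq _ _ Tzu).
  by rewrite eq_sym (neq _ _ Tau).
- have az : a != z by apply: contraNneq Nxz => <-.
  have bz : z != b by apply: contraNneq Nxz => ->.
  have aw : a != w by apply: contraNneq Nwu => <-.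
  have bu : u != b by apply: contraNneq Nuw => ->.
  have [ab|ab] := eqVneq a b.
    case: (cyc [:: a; u; z; w]) => //=; first by rewrite Tau Tuz Tzw ab adj_sym Tbw.
    by rewrite !inE !negb_or az aw uw (neq _ _ Tau) (neq _ _ Tuz) (neq _ _ Tzw).
  case: (cyc [:: x; a; u; z; w; b]) => //=.
    by rewrite Txa Tau Tuz Tzw [T w b]adj_sym Tbw [T b x]adj_sym Txb.
  rewrite !inE !negb_or xu xz xw az aw uw bz bu ab.
  rewrite (neq _ _ Txa) (neq _ _ Txb) (neq _ _ Tau) (neq _ _ Tuz) (neq _ _ Tzw).
  by rewrite eq_sym (neq _ _ Tbw).
Qed.

Section SplitGraph.
Variables (V : finType) (G : sgraph V) (X Y : {set V}).
Hypothesis Gsplit : split_graph G X Y.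

Lemma split_cover x : x \notin X -> x \in Y.
Proof.
by case: Gsplit => XY _ _ _ xX; have := in_setT x; rewrite -XY inE (negPf xX).
Qed.

Lemma split_clique x y : x \in X -> y \in X -> x != y -> G x y.
Proof.
case: Gsplit => _ _ /maxsetP[/forallP cl _] _ xX yX xy.
by have /implyP/(_ xX)/forallP/(_ y)/implyP/(_ yX)/implyP := cl x; apply.
Qed.

Lemma split_independent x y : x \in Y -> y \in Y -> ~~ G x y.
Proof.
case: Gsplit => _ _ _ /forallP ind xY yY.
by have /implyP/(_ xY)/forallP/(_ y)/implyP/(_ yY) := ind x.
Qed.

Lemma split_neighbour y x : y \in Y -> G y x -> x \in X.
Proof.
by move=> yY; apply: contraTT => /split_cover; apply: split_independent.
Qed.

(** Otherwise [y |: X] would be a larger clique. *)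
Lemma split_nonneighbour y : y \notin X -> exists2 x, x \in X & ~~ G y x.
Proof.
move=> yX; apply/exists_inP; rewrite -negb_forall_in; apply/negP=> /forall_inP all.
case: Gsplit => _ _ /maxsetP[_ maxX] _.
have yX1 : y \in y |: X by rewrite setU11.
have := maxX (y |: X); rewrite subsetUr => e; move: yX1; rewrite e ?(negPf yX) //.
apply/forall_inP=> a aX; apply/forall_inP=> b bX; apply/implyP=> ab.
move: aX bX => /setU1P[ea|aX] /setU1P[eb|bX].
- by rewrite ea eb eqxx in ab.
- by rewrite ea all.
- by rewrite eb adj_sym all.
- exact: split_clique.
Qed.

(** If [X] had at most two vertices, [G] would be a tree and its own tree 1-spanner. Indeed a vertex
    outside [X] on a cycle has two neighbours and a nonneighbour in [X], and a cycle inside [X]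
    would be too short. *)
Lemma split_stretch2_clique : connected G -> is_stretch_index G 2 -> 2 < #|X|.
Proof.
move=> Gconn [_ min2]; rewrite ltnNge; apply/negP=> X2.
suff : 2 <= 1 by [].
apply: min2; exists G; split; last by move=> u w /dist_adj.
split; first by [].
split=> // s cyc; rewrite leqNgt; apply/negP=> s3.
have sX x : x \in s -> x \in X.
  move=> /(ucycle_neighbours cyc s3)[y [z [yz Gxy Gxz]]].
  apply: contraT => xX; have xY := split_cover xX.
  have [w wX Nxw] := split_nonneighbour xX.
  have := X2; rewrite leqNgt => /negP[]; apply/card_gt2P; exists y, z, w.
  have ne a : G x a -> a != w by apply: contraTneq => ->.
  split; first by split=> //; [apply: split_neighbour xY Gxy | apply: split_neighbour xY Gxz].
  by split; rewrite ?ne // eq_sym ne.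
suff : size s <= #|X| by lia.
case/andP: cyc => _ /card_uniqP <-; apply/subset_leq_card/subsetP; exact: sX.
Qed.

(** The centre of the star spanning [X] lies in [X] by maximality. A nonpendant vertex of [Y] not
    adjacent to it would form a 4-cycle of [T] with the centre and two of its own neighbours. *)
Lemma split_universal : connected G -> is_stretch_index G 2 ->
  exists2 z, z \in X & forall v, v \notin pendant G -> v != z -> G z v.
Proof.
move=> Gconn Gstretch; have X3 := split_stretch2_clique Gconn Gstretch.
have V3 : 2 < #|V| := leq_trans X3 (max_card _).
have [[T [[/= TG [_ acT]] T2]] _] := Gstretch.
have near u w : G u w -> T u w \/ exists z, T u z /\ T z w.
  by move=> Guw; apply: dist_leq2 V3 (adj_neq Guw) (T2 _ _ Guw).
have [z zT] : exists z, {in X, forall x, x != z -> T z x}.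
  apply: star_center acT X3 _ => x y xX yX xy; apply: near; exact: split_clique.
have zX : z \in X.
  apply: contraT => zX; have [x xX /negP[]] := split_nonneighbour zX.
  by apply/TG/zT => //; apply: contraNneq zX => <-.
exists z => // y yP yz; have [yX|yX] := boolP (y \in X).
  by apply: split_clique; rewrite // eq_sym.
have yY := split_cover yX.
have [x1 [x2 [Gy1 Gy2 x12]]] : exists x1 x2, [/\ G y x1, G y x2 & x1 != x2].
  suff /card_gt1P[x1 [x2 [/[!inE] ? ? ?]]] : 1 < #|[set x | G y x]| by exists x1, x2.
  rewrite ltn_neqAle eq_sym; move: yP; rewrite inE /degree => -> /=.
  have /connectP[[|a p] /= ] := Gconn y z; first by move=> _ e; rewrite e eqxx in yz.
  by case/andP=> Gya _ _; apply/card_gt0P; exists a; rewrite inE.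
apply: contraT => Nzy.
have cyc s : cycle T s -> uniq s -> 2 < size s -> False.
  by move=> cs us; rewrite ltnNge (acyclic_cycle acT cs us).
have neq a b : T a b -> (a == b) = false by move/adj_neq/negPf.
(* A detour from [y] to [x] through [a] would stay in [X] after [y] and close the triangle [z], [a],
   [x] in [T]. *)
have direct x : G y x -> x != z /\ T y x.
  move=> Gyx; have xz : x != z by apply: contraNneq Nzy => <-; rewrite adj_sym.
  split=> //; have xX := split_neighbour yY Gyx.
  have [//|[a [Tya Tax]]] := near y x Gyx.
  have aX := split_neighbour yY (TG _ _ Tya).
  have az : a != z by apply: contraNneq Nzy => <-; rewrite adj_sym TG.
  have Tza := zT a aX az; have Tzx := zT x xX xz.
  case: (cyc [:: z; a; x]) => //=; first by rewrite Tza Tax adj_sym Tzx.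
  by rewrite !inE !negb_or (neq _ _ Tza) (neq _ _ Tax) eq_sym xz.
have [x1z Ty1] := direct x1 Gy1; have [x2z Ty2] := direct x2 Gy2.
have Tz1 := zT x1 (split_neighbour yY Gy1) x1z.
have Tz2 := zT x2 (split_neighbour yY Gy2) x2z.
case: (cyc [:: y; x1; z; x2]) => //=.
  by rewrite Ty1 adj_sym Tz1 Tz2 adj_sym Ty2.
by rewrite !inE !negb_or yz x1z x12 (neq _ _ Ty1) (neq _ _ Ty2) (neq _ _ Tz2).
Qed.

End SplitGraph.

(* An edge at a pendant vertex sees fewer than k elements, all at its other end,
   and the pendant vertex itself has to avoid only two colours. *)
Lemma total_colorable_pendant (V : finType) (G : sgraph V) k :
  {in pendant G &, forall x y, ~~ G x y} ->
  max_degree G < k -> 2 < k ->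
  total_colorable (induced G (~: pendant G)) k -> total_colorable G k.
Proof.
set P := pendant G => indP ltk k3 /total_colorable_coloring[cv0 [ce0 [c1 c2 c3 c4]]].
pose d : 'I_k := Ordinal (ltnW (ltnW k3)).
pose ins (x : V) : option {z | z \in ~: P} := insub x.
pose cv1 x := if ins x is Some x' then cv0 x' else d.
pose ce1 x y := if ins x is Some x' then
                  if ins y is Some y' then ce0 x' y' else d else d.
have insE x : x \notin P -> exists2 x', ins x = Some x' & val x' = x.
  by rewrite -in_setC => xP; exists (Sub x xP); rewrite ?/ins ?insubT.
have d1 x y : x \notin P -> y \notin P -> G x y -> cv1 x != cv1 y.
  by move=> /insE[x' ex <-] /insE[y' ey <-]; rewrite /cv1 /ins !valK; apply: c1.
have d2 x y : x \notin P -> y \notin P -> G x y -> ce1 x y = ce1 y x.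
  by move=> /insE[x' ex <-] /insE[y' ey <-]; rewrite /ce1 /ins !valK; apply: c2.
have d3 x y : x \notin P -> y \notin P -> G x y -> cv1 x != ce1 x y.
  by move=> /insE[x' ex <-] /insE[y' ey <-]; rewrite /cv1 /ce1 /ins !valK; apply: c3.
have d4 x y z : x \notin P -> y \notin P -> z \notin P -> G x y -> G x z ->
    y != z -> ce1 x y != ce1 x z.
  move=> /insE[x' ex <-] /insE[y' ey <-] /insE[z' ez <-].
  by rewrite /ce1 /ins !valK (inj_eq val_inj); apply: c4.
pose leaves x := [set p in P | G x p].
(* At most [1 + degree G x - #|leaves x|] colours are used at [x] so far, and [degree G x < k], so
   enough remain for the pendant edges. *)
pose free x := ~: (cv1 x |: ce1 x @: [set y | G x y & y \notin P]).
have le_free x : #|leaves x| <= #|free x|.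
  have : degree G x < k by apply: leq_ltn_trans ltk; apply: leq_bigmax.
  rewrite /degree -(cardsID P) [#|free x|]cardsCs setCK card_ord cardsU1.
  have := leq_imset_card (ce1 x) [set y | G x y & y \notin P].
  have -> : [set y | G x y] :&: P = leaves x by apply/setP=> y; rewrite !inE andbC.
  have -> : [set y | G x y] :\: P = [set y | G x y & y \notin P].
    by apply/setP=> y; rewrite !inE andbC.
  case: (_ \notin _); lia.
have /fin_all_exists[h hP] x := inj_between (fun=> d) (le_free x).
have h_inj x : {in leaves x &, injective (h x)} by case: (hP x).
have h_free x p : p \in P -> G x p -> h x p != cv1 x /\
    forall y, y \notin P -> G x y -> h x p != ce1 x y.
  move=> pP Gxp; have [_ /(_ p)] := hP x; rewrite !inE negb_or in pP *.
  rewrite pP Gxp => /(_ isT)/andP[hc /imsetP he]; split=> // y yP Gxy.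
  by apply/eqP=> e; apply: he; exists y => //; rewrite inE Gxy.
pose nbr p := odflt p [pick x | G p x].
have nbrE p x : p \in P -> G p x -> nbr p = x.
  rewrite inE /degree => /cards1P[w ew] Gpx.
  have eqw v : G p v -> v = w by move=> Gpv; apply/set1P; rewrite -ew inE.
  rewrite /nbr; case: pickP => [v /eqw-> /=|/(_ x)]; last by rewrite Gpx.
  exact/esym/eqw.
(* Only the colours of its neighbour and of its edge are forbidden, and [2 < k]. *)
pose cvP p := odflt d [pick c | c \notin [set cv1 (nbr p); h (nbr p) p]].
have cvPE p : cvP p \notin [set cv1 (nbr p); h (nbr p) p].
  rewrite /cvP; case: pickP => [//|none].
  have : #|'I_k| <= #|[set cv1 (nbr p); h (nbr p) p]|.
    by apply/subset_leq_card/subsetP=> c _; have := none c; rewrite /= => /negbFE.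
  by rewrite card_ord cards2; case: (_ != _); lia.
have {}cvPE p x : p \in P -> G p x -> cvP p != cv1 x /\ cvP p != h x p.
  by move=> pP Gpx; have := cvPE p; rewrite (nbrE p x) // !inE negb_or => /andP[].
pose cv x := if x \in P then cvP x else cv1 x.
pose ce x y := if y \in P then h x y else if x \in P then h y x else ce1 x y.
apply: (@total_coloring_colorable _ _ G cv ce); last by rewrite card_ord.
split.
- move=> x y Gxy; have Gyx : G y x by rewrite adj_sym.
  rewrite /cv; case: ifPn => xP; case: ifPn => yP.
  + by have := indP x y xP yP; rewrite Gxy.
  + by case: (cvPE x y xP Gxy).
  + by rewrite eq_sym; case: (cvPE y x yP Gyx).
  + exact: d1.
- move=> x y Gxy; rewrite /ce; case: ifPn => yP; case: ifPn => xP //.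
  + by have := indP x y xP yP; rewrite Gxy.
  + exact: d2.
- move=> x y Gxy; rewrite /cv /ce; case: (ifPn (y \in P)) => yP; case: ifPn => xP.
  + by have := indP x y xP yP; rewrite Gxy.
  + by rewrite eq_sym; case: (h_free x y yP Gxy).
  + by case: (cvPE x y xP Gxy).
  + exact: d3.
- move=> x y z Gxy Gxz yz.
  have xP : x \notin P.
    by apply: contra yz => xP; rewrite -(nbrE x y xP Gxy) (nbrE x z xP Gxz).
  rewrite /ce (negPf xP); case: ifPn => yP; case: ifPn => zP.
  + by apply: contraNneq yz => /h_inj-> //; rewrite inE ?yP ?zP.
  + by case: (h_free x y yP Gxy) => _; apply.
  + by rewrite eq_sym; case: (h_free x z zP Gxz) => _; apply.
  + exact: d4.
Qed.

(** * Reduction of Type 2 to Hilton's theorem *)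

Lemma max_degree_universal (V : finType) (G : sgraph V) z :
  (forall v, v != z -> G z v) -> max_degree G = #|V|.-1.
Proof.
move=> uz; have card1 (x : V) : #|[set~ x]| = #|V|.-1 by rewrite cardsC1.
apply/eqP; rewrite eqn_leq; apply/andP; split.
  apply/bigmax_leqP=> x _; rewrite -(card1 x); apply/subset_leq_card/subsetP=> y.
  by rewrite !inE eq_sym; apply: adj_neq.
apply: leq_trans (leq_bigmax z); rewrite -(card1 z).
by apply/subset_leq_card/subsetP=> y; rewrite !inE; apply: uz.
Qed.

Lemma max_degree_induced (V : finType) (G : sgraph V) S :
  max_degree (induced G S) <= max_degree G.
Proof.
apply/bigmax_leqP=> x _; apply: leq_trans (leq_bigmax (val x)).
rewrite /degree -(card_imset _ val_inj); apply/subset_leq_card/subsetP.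
by move=> _ /imsetP[y /[!inE] Gxy ->].
Qed.

Lemma hilton_conditionE (V : finType) (G : sgraph V) :
  hilton_condition G <-> 2 * (#|edges (compl G)| + matching_number (compl G)) < #|V|.
Proof.
rewrite /hilton_condition Num.Theory.ltr_pdivlMr ?Num.Theory.ltr0n //.
by rewrite -GRing.natrM Num.Theory.ltr_nat mulnC.
Qed.

(** Colourability is monotone in the number of colours, so the minimum is the given upper bound
    exactly when one colour fewer fails. *)
Lemma type2E (V : finType) (G : sgraph V) :
  total_colorable G (max_degree G + 2) ->
  type2 G <-> ~~ total_colorable G (max_degree G).+1.
Proof.
rewrite addn2 => col2; rewrite /type2 /total_chromatic_number addn2.
case: ex_minnP => m colm minm; split=> [em|ncol].
  by apply: contraT => /negPn/minm; rewrite em ltnn.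
apply/eqP; rewrite eqn_leq minm // ltnNge.
by apply: contra ncol => /total_colorable_leq; apply.
Qed.

(** As [X] is a clique, every edge of the complement has an end in [Y]; as [Y] is independent, two
    such ends coincide or are joined in the complement. *)
Lemma split_compl_linked (V : finType) (G : sgraph V) (X Y S : {set V}) :
  split_graph G X Y -> linked_edges (compl (induced G S)).
Proof.
move=> Gsplit A B; set J := compl _ => AJ BJ.
have inY D : D \in edges J -> exists2 y, y \in D & val y \in Y.
  case/edgesP=> a [b [/andP[ab Nab] ->]].
  have [aX|/(split_cover Gsplit) aY] := boolP (val a \in X); last first.
    by exists a; rewrite // !inE eqxx.
  have [bX|/(split_cover Gsplit) bY] := boolP (val b \in X); last first.
    by exists b; rewrite // !inE eqxx orbT.
  by case/negP: Nab; apply: split_clique Gsplit _ _ aX bX _; rewrite (inj_eq val_inj).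
have meets (C D : {set {z | z \in S}}) x : x \in C -> x \in D -> ~~ [disjoint C & D].
  by move=> xC xD; apply/pred0Pn; exists x; rewrite /= xC.
have [a aA aY] := inY A AJ; have [b bB bY] := inY B BJ.
have [ab|ab] := eqVneq a b.
  by exists A; split=> //; apply: (meets _ _ a); rewrite ?ab // -ab.
exists [set a; b]; split.
- by rewrite mem_edges /= ab (split_independent Gsplit).
- by apply: (meets _ _ a) => //; rewrite !inE eqxx.
- by apply: (meets _ _ b) => //; rewrite !inE eqxx orbT.
Qed.

Theorem theorem11 (V : finType) (G : sgraph V) (X Y : {set V})
  (Gconn : connected G) (Gsplit : split_graph G X Y)
  (Gstretch : is_stretch_index G 2) (Godd : odd (max_degree G)) :
  let H := induced G (~: pendant G) in
  type2 G <-> (max_degree H = max_degree G /\ hilton_condition H).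
Proof.
move=> H; pose N := #|{: {z | z \in ~: pendant G}}|.
have X3 := split_stretch2_clique Gsplit Gconn Gstretch.
have [z zX zuniv] := split_universal Gsplit Gconn Gstretch.
have degX x : x \in X -> 1 < degree G x.
  move=> xX; rewrite -ltnS (leq_trans X3) // (cardsD1 x) xX ltnS.
  apply/subset_leq_card/subsetP=> y; rewrite !inE => /andP[yx yX].
  by apply: split_clique Gsplit _ _ xX yX _; rewrite eq_sym.
have D1 : 1 < max_degree G by apply: leq_trans (degX z zX) (leq_bigmax z).
have pendY x : x \in pendant G -> x \in Y.
  move=> xP; apply: (split_cover Gsplit); apply: contraL xP => /degX.
  by rewrite inE neq_ltn orbC => ->.
have pend_indep : {in pendant G &, forall x y, ~~ G x y}.
  by move=> x y /pendY xY /pendY yY; apply: split_independent Gsplit _ _ xY yY.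
have zP : z \in ~: pendant G by rewrite !inE neq_ltn degX ?orbT.
(* The universal vertex [z] survives in [H], since clique vertices have degree at least 2. *)
have DH : max_degree H = N.-1.
  apply: (@max_degree_universal _ H (Sub z zP)) => v vz.
  by apply: zuniv; [rewrite -in_setC (valP v) | rewrite -(inj_eq val_inj) in vz].
have N0 : 0 < N by apply/card_gt0P; exists (Sub z zP).
have leD : N <= (max_degree G).+1.
  by have := max_degree_induced G (~: pendant G); rewrite -/H DH; lia.
have extend k : max_degree G < k -> total_colorable H k -> total_colorable G k.
  by move=> ltk; apply: total_colorable_pendant => //; lia.
have restrict k : total_colorable G k -> total_colorable H k.
  exact: total_colorable_embed val_inj _.
(* [max_degree G + 2] is odd and exceeds the order of [H]. *)
have col2 : total_colorable G (max_degree G + 2).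
  apply: extend; first by lia.
  by apply: total_colorable_odd; [lia | rewrite -/N; lia].
rewrite (type2E col2) hilton_conditionE -/N; split=> [ncol|[eD hil]].
  (* If [max_degree H] were smaller, [N] would be at most the odd number [max_degree G], and that
     many colours would suffice for [H]. *)
  have eD : max_degree H = max_degree G.
    apply/eqP; rewrite eqn_leq max_degree_induced leqNgt; apply: contra ncol => lt.
    apply: extend => //; apply: (total_colorable_leq (leqnSn _)).
    by apply: total_colorable_odd; rewrite // -/N; lia.
  split=> //; rewrite ltnNge; apply: contra ncol => hil; apply: extend => //.
  have -> : (max_degree G).+1 = N by lia.
  (* [N] is even, being one more than an odd number, and at least 4 since [max_degree G] exceeds
     1. *)
  apply: (@hilton_sufficient _ H (compl H)); rewrite -/N //; try lia.
    by move=> x y Hxy; apply/negP=> /andP[_ /negP[]].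
  exact: split_compl_linked Gsplit.
apply: contraL hil => /restrict col; rewrite -leqNgt.
have eN : (max_degree G).+1 = N by lia.
rewrite -{1}eN; apply: hilton_necessary => //; rewrite -/N; lia.
Qed.
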